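(* Let $u$ be the solution of the Poisson problem $-\Delta u=f$ in $\Omega$, $u=0$ on $\partial\Omega$, and let $u_h\in V_h$ be its finite element approximation, i.e. $a_h(u_h,v_h)=(f,v_h)$ for all $v_h\in V_h$. Assume there exist a subdomain $G\subset\subset\Omega$ such that $u\in W^{r+\delta,p}(G)$ $(\delta>0)$ and a multi-index $\gamma$ with $|\gamma|=r$ such that $\|D^\gamma u\|_{0,p,G}>0$ and $D^\gamma v_h=0$ for any $v_h\in V_h$. If the family $\{\mathcal{T}_h\}$ of partitions is regular, the finite element solution $u_h$ has the following lower bounds of the discretization error: $$\Big(\sum_{K\in\mathcal{T}_h^G}h_K^{p(j-r)}\|u-u_h\|_{j,p,K}^p\Big)^{1/p}\ \ge\ C_{11},\qquad 0\le j\le r,$$ and $$\Big(\sum_{K\in\mathcal{T}_h^G}h_K^{p\left((j-r)+n\left(\frac1p-\frac1q\right)\right)}\|u-u_h\|_{j,q,K}^p\Big)^{1/p}\ \ge\ C_{12},\qquad 0\le j\le r,$$ where $1\le p<\infty$, $1\le q\le\infty$ (such that $W^{r+\delta,p}(G)$ can be imbedded into $W^{j,q}(G)$), and $C_{11}$ and $C_{12}$ are positive constants, independent of the mesh size $h$ but dependent on $u$.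
   Context: $\Omega\subset\mathbb{R}^n$ ($n\ge1$) is a bounded polytopic domain with Lipschitz continuous boundary. $W^{s,p}(G)$ denotes the usual Sobolev space with norm $\|\cdot\|_{s,p,G}$; $D^\alpha$ is the partial derivative of multi-index $\alpha$ and $|\alpha|=\sum_i\alpha_i$. $G\subset\subset\Omega$ means $G\subset\Omega$, $\mathrm{dist}(\partial\Omega,G)>0$ and $\mathrm{meas}(G)>0$. $(\cdot,\cdot)$ is the $L^2(\Omega)$ inner product; $f$ is a given right-hand side. $\mathcal{T}_h$ is a face-to-face partition of $\Omega$ into elements $K$ (triangles, rectangles, tetrahedra, bricks, etc.), so $\bar\Omega=\bigcup_{K\in\mathcal{T}_h}K$; $h_K=\mathrm{diam}\,K$ and $h=\max_{K\in\mathcal{T}_h}h_K$. $\mathcal{T}_h^G=\{K\in\mathcal{T}_h: K\subset G\}$. A family $\{\mathcal{T}_h\}$ is regular if there is $\sigma>0$ with $h_K/\tau_K<\sigma$ for all $K\in\mathcal{T}_h$, where $\tau_K$ is the maximum diameter of an inscribed ball in $K$. $V_h$ is a suitable finite element space (conforming or nonconforming for the second order elliptic problem) of piecewise polynomials of degree less than $r$ ($r\ge1$ an integer) on $\mathcal{T}_h$; derivatives of $v_h\in V_h$ are taken element by element, and $a_h(u_h,v_h)=\sum_{K\in\mathcal{T}_h}\int_K\nabla u_h\cdot\nabla v_h\,dK$. $\|\cdot\|_{j,q,K}$ is the $W^{j,q}(K)$ norm.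
   Formalization: The lower bounds are stated for all meshes with h below some threshold h0 > 0, since on a coarse mesh with no element inside G the left sides are 0 and no positive constant works; ''degree less than r'' is read as total degree. *)

(* Defs.v *)
From HB Require Import structures.
From mathcomp Require Import all_boot all_order all_algebra.
From mathcomp Require Import all_classical all_reals all_analysis.

Set Implicit Arguments.
Unset Strict Implicit.
Unset Printing Implicit Defensive.
Import Order.TTheory GRing.Theory Num.Theory.
Import numFieldNormedType.Exports.
Local Open Scope classical_set_scope.
Local Open Scope ring_scope.

(* Throughout, R^n is 'rV[R]_n: the topology is the library's (sup norm) one,
   lengths and distances are Euclidean, and the sigma-algebra is the Borel one
   (generated by the coordinates), so that measurable functions are Borel
   representatives of their Lebesgue classes. *)

Definition rV_display : measure_display -> measure_display.
Proof. exact. Qed.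

Section measurable_rV.
Context {d} {T : measurableType d}.
Variable n : nat.

Let coors : 'I_n -> 'rV[T]_n -> T := fun i x => x ord0 i.

Let rV_set0 : g_sigma_preimage coors set0.
Proof. exact: sigma_algebra0. Qed.

Let rV_setC A : g_sigma_preimage coors A -> g_sigma_preimage coors (~` A).
Proof. exact: sigma_algebraC. Qed.

Let rV_bigcup (F : _^nat) : (forall i, g_sigma_preimage coors (F i)) ->
  g_sigma_preimage coors (\bigcup_i (F i)).
Proof. exact: sigma_algebra_bigcup. Qed.

HB.instance Definition _ := @isMeasurable.Build (rV_display d)
  'rV[T]_n (g_sigma_preimage coors) rV_set0 rV_setC rV_bigcup.

End measurable_rV.

Lemma measurable_coord_rV d (T : measurableType d) n (i : 'I_n) :
  measurable_fun [set: 'rV[T]_n] (fun x => x ord0 i).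
Proof.
move=> _ Y mY; rewrite setTI; apply: sub_sigma_algebra => /=.
rewrite -bigcup_seq/=; exists i => /=; first by rewrite mem_index_enum.
by exists Y => //; rewrite setTI.
Qed.

Lemma measurable_fun_rV d1 d2 (T1 : measurableType d1) (T2 : measurableType d2)
    n (f : T1 -> 'rV[T2]_n) :
  (forall i, measurable_fun [set: T1] (fun x => f x ord0 i)) ->
  measurable_fun [set: T1] f.
Proof.
move=> mf.
have sub : g_sigma_preimage (fun i x => f x ord0 i) `<=` @measurable _ T1.
  apply: smallest_sub; first exact: sigma_algebra_measurable.
  case: n => [|n] in f mf *; first by rewrite big_ord0.
  rewrite -bigcup_mkord_ord; apply: bigcup_sub => i Ii.
  by move=> A [B mB <-]; exact: mf.
move=> _ A mA; apply: sub.
have -> : g_sigma_preimage (fun i (x : T1) => f x ord0 i) =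
    preimage_set_system [set: T1] f
      (g_sigma_preimage (fun i (x : 'rV[T2]_n) => x ord0 i)).
  exact: (g_sigma_preimage_comp (fun i (x : 'rV[T2]_n) => x ord0 i) f).
by exists A.
Qed.

Definition cons_rV {T} n (tx : T * 'rV[T]_n) : 'rV[T]_n.+1 :=
  \row_i (if unlift ord0 i is Some j then tx.2 ord0 j else tx.1).

Definition uncons_rV {T} n (x : 'rV[T]_n.+1) : T * 'rV[T]_n :=
  (x ord0 ord0, \row_i x ord0 (lift ord0 i)).

Lemma cons_rVK {T} n : cancel (@cons_rV T n) (@uncons_rV T n).
Proof.
move=> [t x]; rewrite /uncons_rV /cons_rV mxE unlift_none; congr (_, _).
by apply/rowP => i; rewrite !mxE liftK.
Qed.

Lemma measurable_cons_rV d (T : measurableType d) n :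
  measurable_fun [set: T * 'rV[T]_n] (@cons_rV T n).
Proof.
apply: measurable_fun_rV => i; rewrite /cons_rV.
under eq_fun do rewrite mxE.
case: (unlift ord0 i) => [j|] /=; last exact: measurable_fst.
exact: (measurableT_comp (measurable_coord_rV j) measurable_snd).
Qed.

Lemma measurable_uncons_rV d (T : measurableType d) n :
  measurable_fun [set: 'rV[T]_n.+1] (@uncons_rV T n).
Proof.
apply: measurable_fun_pair => /=; first exact: measurable_coord_rV.
apply: measurable_fun_rV => i; under eq_fun do rewrite mxE.
exact: measurable_coord_rV.
Qed.


(* Reproved here: the instance of the library is shadowed by the one for
   products of subprobabilities. *)
Lemma product_measure_sigma_finite d1 d2 (T1 : measurableType d1)
    (T2 : measurableType d2) (R : realType)
    (m1 : {sigma_finite_measure set T1 -> \bar R})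
    (m2 : {sigma_finite_measure set T2 -> \bar R}) :
  sigma_finite setT (m1 \x m2)%E.
Proof.
have /sigma_finiteP[F [TF ndF Foo]] := sigma_finiteT m1.
have /sigma_finiteP[G [TG ndG Goo]] := sigma_finiteT m2.
exists (fun n => F n `*` G n).
 rewrite -setXTT TF TG predeqE => -[x y]; split.
    move=> [/= [n _ Fnx] [k _ Gky]]; exists (maxn n k) => //; split.
    - by move: x Fnx; exact/subsetPset/ndF/leq_maxl.
    - by move: y Gky; exact/subsetPset/ndG/leq_maxr.
  by move=> [n _ []/= ? ?]; split; exists n.
move=> k; have [? ?] := Foo k; have [? ?] := Goo k.
split; first exact: measurableX.
by rewrite product_measure1E// lte_mul_pinfty// ge0_fin_numE.
Qed.

Section lebesgue_step.
Context {R : realType} (n : nat).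
Variable mu : {sigma_finite_measure set 'rV[R]_n -> \bar R}.
Local Open Scope ereal_scope.

Let prodmu := @lebesgue_measure R \x mu.
Let f : measurableTypeR R * 'rV[R]_n -> 'rV[R]_n.+1 := @cons_rV R n.
Let g : 'rV[R]_n.+1 -> measurableTypeR R * 'rV[R]_n := @uncons_rV R n.

Let mf : measurable_fun [set: measurableTypeR R * 'rV[R]_n] f.
Proof. exact: measurable_cons_rV. Qed.

Let mg : measurable_fun [set: 'rV[R]_n.+1] g.
Proof. exact: measurable_uncons_rV. Qed.

Definition lebesgue_step : set 'rV[R]_n.+1 -> \bar R := pushforward prodmu f.

Let pm := measure_function_pushforward__canonical__measure_function_Measure prodmu mf.

HB.instance Definition _ := isMeasure.Build _ _ _ lebesgue_step
  (measure0 pm) (measure_ge0 pm) (@measure_semi_sigma_additive _ _ _ pm).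

Let lebesgue_step_sigma_finite : sigma_finite setT lebesgue_step.
Proof.
have [F TF Foo] := product_measure_sigma_finite (@lebesgue_measure R) mu.
exists (fun k => g @^-1` F k) => [|k].
  by rewrite -preimage_bigcup -TF preimage_setT.
have [mF Fk] := Foo k; split; first by rewrite -[X in measurable X]setTI; exact: mg.
rewrite /lebesgue_step /pushforward -comp_preimage.
by rewrite (_ : g \o f = id) //; apply/funext => x; exact: cons_rVK.
Qed.

HB.instance Definition _ := Measure_isSigmaFinite.Build _ _ _ lebesgue_step
  lebesgue_step_sigma_finite.
End lebesgue_step.

(* Lebesgue measure on R^n: lebesgue_rV m.+1 is the image of the product of the
   Lebesgue measures of R and R^m under (t, x) |-> the row t, x_0, ..., x_m-1. *)
Fixpoint lebesgue_rV {R : realType} (n : nat) :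
    {sigma_finite_measure set 'rV[R]_n -> \bar R} :=
  if n is m.+1 then lebesgue_step (lebesgue_rV m) else \d_(0%R : 'rV[R]_0).

Section euclidean.
Context {R : realType} {n : nat}.
Implicit Types (x y : 'rV[R]_n) (A B D K : set 'rV[R]_n).

Definition dotp x y : R := \sum_(i < n) x ord0 i * y ord0 i.

Definition enorm x : R := Num.sqrt (dotp x x).

Definition edist A B : R := inf [set enorm (x - y) | x in A & y in B].

Definition ediam A : R := sup [set enorm (x - y) | x in A & y in A].

Definition inball_diam A : R :=
  sup [set d | 0 <= d /\ exists x, forall y, enorm (y - x) <= d / 2 -> A y].

Definition frontier A : set 'rV[R]_n := closure A `\` A°.

Definition is_domain D : Prop := [/\ open D, connected D & D !=set0].

Definition compactly_inside G D : Prop :=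
  [/\ G `<=` D, 0 < edist (frontier D) G & (0 < lebesgue_rV n G)%E].

Definition is_polytope K : Prop :=
  exists (k : nat) (P : 'I_k -> 'rV[R]_n),
    K = [set x | exists a : 'I_k -> R, [/\ forall i, 0 <= a i,
           \sum_i a i = 1 & x = \sum_i a i *: P i]].

(* Exposed faces; for a polytope these are all its faces, including the
   polytope itself and the empty face. *)
Definition is_face F K : Prop :=
  exists (a : 'rV[R]_n) (c : R),
    (forall x, K x -> dotp a x <= c) /\ F = K `&` [set x | dotp a x = c].

Definition is_polytopic D : Prop :=
  exists P : set (set 'rV[R]_n), [/\ finite_set P,
    forall K, P K -> is_polytope K & closure D = \bigcup_(K in P) K].

(* Near each boundary point, D is the set of points lying above the graph of a
   Lipschitz function, where e is the vertical direction and the hyperplane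
   orthogonal to e is horizontal: y - (y.e) e is the horizontal part of y. *)
Definition lipschitz_boundary D : Prop :=
  forall x, frontier D x ->
  exists (e : 'rV[R]_n) (phi : 'rV[R]_n -> R) (L rho : R),
    [/\ enorm e = 1, 0 < rho,
        forall y z, `|phi y - phi z| <= L * enorm (y - z) &
        forall y, enorm (y - x) < rho ->
          (D y <-> phi (y - dotp y e *: e) < dotp y e)].

End euclidean.

Definition mindex (n : nat) := {ffun 'I_n -> nat}.

Definition mi_order n (alpha : mindex n) : nat := (\sum_(i < n) alpha i)%N.

Definition mi_unit n (i : 'I_n) : mindex n := [ffun j => (j == i) : nat].

Section sobolev.
Context {R : realType} {n : nat}.
Local Notation mu := (@lebesgue_rV R n).
Implicit Types (D : set 'rV[R]_n) (u v w phi : 'rV[R]_n -> R).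
Implicit Types (alpha : mindex n) (s : seq 'I_n).

Definition iter_partial s phi : 'rV[R]_n -> R :=
  foldr (fun i g => 'D_(delta_mx ord0 i) g) phi s.

(* The classical derivative D^alpha. *)
Definition cderiv alpha phi : 'rV[R]_n -> R :=
  iter_partial (flatten [seq nseq (alpha i) i | i <- enum 'I_n]) phi.

Definition smooth phi : Prop :=
  forall s, continuous (iter_partial s phi) /\
    forall i x, derivable (iter_partial s phi) x (delta_mx ord0 i).

Definition test_function D phi : Prop :=
  smooth phi /\ exists K, [/\ compact K, K `<=` D &
                            forall x, ~ K x -> phi x = 0].

Definition loc_integrable D u : Prop :=
  measurable_fun D u /\
  forall K, K `<=` D -> compact K ->
    (\int[mu]_(x in K) `|u x|%:E < +oo)%E.

Definition is_weak_deriv D alpha u v : Prop :=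
  [/\ loc_integrable D u, loc_integrable D v &
      forall phi, test_function D phi ->
        \int[mu]_(x in D) (u x * cderiv alpha phi x) =
        (-1) ^+ mi_order alpha * \int[mu]_(x in D) (v x * phi x)].

(* The weak derivative D^alpha u on D; a junk value (0) if there is none, which
   is why Sobolev membership below also asks for existence. *)
Definition wderiv D alpha u : 'rV[R]_n -> R :=
  xget (fun=> 0) [set v | is_weak_deriv D alpha u v].

Definition Lp_norm D (q : \bar R) u : \bar R :=
  'N[mu]_q[EFin \o (u \_ D)].

Definition in_Lp D (q : \bar R) u : Prop :=
  measurable_fun D u /\ (Lp_norm D q u < +oo)%E.

Definition in_sobolev (m : nat) (q : \bar R) D u : Prop :=
  forall alpha, (mi_order alpha <= m)%N ->
    (exists v, is_weak_deriv D alpha u v) /\ in_Lp D q (wderiv D alpha u).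

Definition sobolev_norm (m : nat) (q : \bar R) D u : \bar R :=
  let A := [set alpha : mindex n | (mi_order alpha <= m)%N] in
  match q with
  | q'%:E => ((\sum_(alpha \in A)
                Lp_norm D q (wderiv D alpha u) `^ q') `^ q'^-1)%E
  | _ => \big[maxe/0%E]_(alpha \in A) Lp_norm D q (wderiv D alpha u)
  end.

(* W^{s,p}(D) for real s >= 0 and finite p: with m the integer part of s and
   theta = s - m, it is W^{m,p}(D) if theta = 0, and otherwise the
   Sobolev-Slobodeckij space, where the derivatives of order m have in addition
   a finite Gagliardo seminorm of exponent theta. *)
Definition gagliardo_pow (m : nat) (theta p : R) D u : \bar R :=
  (\sum_(alpha \in [set alpha : mindex n | mi_order alpha = m])
    \int[mu]_(x in D) \int[mu]_(y in D)
      (`|wderiv D alpha u x - wderiv D alpha u y| `^ p /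
       enorm (x - y) `^ (n%:R + theta * p))%:E)%E.

Definition in_frac_sobolev (s p : R) D u : Prop :=
  let m := Num.truncn s in let theta := s - m%:R in
  in_sobolev m p%:E D u /\
  (theta != 0 -> (gagliardo_pow m theta p D u < +oo)%E).

Definition frac_sobolev_norm (s p : R) D u : \bar R :=
  let m := Num.truncn s in let theta := s - m%:R in
  ((sobolev_norm m p%:E D u `^ p +
    (if theta == 0%R then 0 else gagliardo_pow m theta p D u)) `^ p^-1)%E.

Definition sobolev_embeds (s p : R) (j : nat) (q : \bar R) D : Prop :=
  exists C : R, forall w, in_frac_sobolev s p D w ->
    in_sobolev j q D w /\
    (sobolev_norm j q D w <= C%:E * frac_sobolev_norm s p D w)%E.

Definition in_H10 D u : Prop :=
  in_sobolev 1 2%:E D u /\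
  forall eps : R, 0 < eps -> exists2 phi, test_function D phi &
    (sobolev_norm 1 2%:E D (u \- phi)%R < eps%:E)%E.

(* u is the weak solution of - Delta u = f in D, u = 0 on the boundary of D. *)
Definition poisson_solution D (f u : 'rV[R]_n -> R) : Prop :=
  in_H10 D u /\
  forall v, in_H10 D v ->
    \int[mu]_(x in D)
      (\sum_(i < n) wderiv D (mi_unit i) u x * wderiv D (mi_unit i) v x) =
    \int[mu]_(x in D) (f x * v x).

End sobolev.

Section finite_elements.
Context {R : realType} {n : nat}.
Local Notation mu := (@lebesgue_rV R n).
Implicit Types (D G K : set 'rV[R]_n) (u v : 'rV[R]_n -> R).
Implicit Types (T : set (set 'rV[R]_n)).

Definition is_partition D T : Prop :=
  [/\ finite_set T,
      forall K, T K -> is_polytope K /\ K° !=set0,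
      closure D = \bigcup_(K in T) K &
      forall K K', T K -> T K' -> K <> K' ->
        [/\ K° `&` K'° = set0, is_face (K `&` K') K & is_face (K `&` K') K']].

Definition mesh_size T : R := sup [set ediam K | K in T].

Definition elements_in T G : set (set 'rV[R]_n) := T `&` [set K | K `<=` G].

Definition regular_family (I : Type) (T : I -> set (set 'rV[R]_n)) : Prop :=
  exists2 sigma : R, 0 < sigma &
    forall i K, T i K -> ediam K / inball_diam K < sigma.

Definition is_poly_deg_lt (r : nat) (P : 'rV[R]_n -> R) : Prop :=
  exists c : mindex n -> R, forall x,
    P x = \sum_(alpha \in [set alpha : mindex n | (mi_order alpha < r)%N])
            c alpha * \prod_(i < n) x ord0 i ^+ alpha i.

(* Only the values in the interiors of the elements matter: no condition is
   imposed across (or on) the inter-element boundaries, so that nonconforming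
   spaces are included. *)
Definition piecewise_poly (r : nat) T v : Prop :=
  forall K, T K -> exists2 P, is_poly_deg_lt r P & forall x, K° x -> v x = P x.

Definition fe_space (r : nat) T (V : set ('rV[R]_n -> R)) : Prop :=
  [/\ forall v, V v -> piecewise_poly r T v, V (fun=> 0) &
      forall (a : R) v w, V v -> V w -> V (fun x => a * v x + w x)].

Definition a_h T u v : R :=
  \sum_(K \in T) \int[mu]_(x in K°)
    (\sum_(i < n) 'D_(delta_mx ord0 i) u x * 'D_(delta_mx ord0 i) v x).

Definition fe_solution D T (V : set ('rV[R]_n -> R)) (f uh : 'rV[R]_n -> R) :
    Prop :=
  V uh /\ forall v, V v -> a_h T uh v = \int[mu]_(x in D) (f x * v x).

End finite_elements.

(* Main.v *)
(* Let w = D^gamma u on G.  On each element K of G put a smooth bump phi_K, the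
   rescaling of a fixed tensor-product bump to a cube inscribed in K of side
   comparable to h_K.  Split D^gamma = D^beta D^s with |beta| = j.  A polynomial of
   degree < r is killed by D^gamma, so integrating by parts
     |int w phi_K| = |int_K D^beta (u - u_h) D^s phi_K|
                  <= C h_K^(j-r) h_K^(n(1-1/q)) ||u - u_h||_{j,q,K}.
   Approximating w in L^1(G) by a Lipschitz function shows that
   sum_K |int w phi_K| stays bounded below by a multiple of int_G |w| > 0 as h -> 0.
   The l^p sum is recovered from this l^1 bound through the tangent inequality
   t^p >= lambda^(p-1) (t - lambda). *)

Require Import Defs.
From mathcomp Require Import all_boot all_order all_algebra.
From mathcomp Require Import all_classical all_reals all_analysis.
From mathcomp Require Import ess_sup_inf measurable_realfun ring lra.

Set Implicit Arguments.
Unset Strict Implicit.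
Unset Printing Implicit Defensive.
Import Order.TTheory GRing.Theory Num.Theory.
Import numFieldNormedType.Exports.
Local Open Scope classical_set_scope.
Local Open Scope ring_scope.

(** * Lebesgue measure on row vectors *)

(** The bumps live in the interiors of the elements because u_h may jump between elements: in an
    interior u_h is a single polynomial, so u - u_h inherits weak derivatives from u, and its
    D^gamma is w itself. The splitting of D^gamma cuts the list of directions of gamma in two, so
    partial derivatives never have to be commuted.

    A coarse mesh may have no element inside G, so the bounds hold below a threshold h0. At least
    half of the mass of |w| lies at points whose eta-ball stays in G; once h < eta, every such point
    belongs to an element contained in G.

    Regularity enters through the inscribed cubes: |K| <= c0 int phi_K, so a bound on sum_K |K|
    |g(x_K)|, with g Lipschitz, gives one on sum_K |int g phi_K|. The bumps have disjoint supports,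
    hence sum_K h_K^n <= V' for a constant V', and lambda = c1 / (2 V') makes the total loss in the
    tangent inequality at most half of the l^1 bound c1. Constants are uniform in j <= r because the
    bounds on the bump are taken over all orders up to r at once. *)

Section borel_rV.
Context {R : realType} {n : nat}.
Implicit Types (x y : 'rV[R]_n).

Lemma ball_rVP x y (e : R) : 0 < e ->
  ball x e y <-> forall i, `|x ord0 i - y ord0 i| < e.
Proof.
move=> e0; split=> [[_ h] i|h]; first exact: h.
by split => // i j; rewrite ord1; exact: h.
Qed.

Lemma measurable_ball_rV x (e : R) : measurable (ball x e).
Proof.
have [e0|e0] := ltP 0 e; last first.
  rewrite (_ : ball x e = set0) //; apply/seteqP; split => // y [].
  by rewrite ltNge e0.
rewrite (_ : ball x e =
    \bigcap_(i in [set: 'I_n]) ((fun y : 'rV[R]_n => y ord0 i) @^-1` ball (x ord0 i) e)).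
  apply: fin_bigcap_measurable => // i _; rewrite -[X in measurable X]setTI.
  apply: measurable_coord_rV => //.
  apply: open_measurable. apply: ball_open.
apply/seteqP; split=> [y /(ball_rVP _ _ e0) h i _|y h]; first exact: h.
by apply/ball_rVP => // i; exact: h.
Qed.

(** The sigma-algebra is generated by coordinate preimages, and a sup-norm ball is a finite
    intersection of these. An open set is the union of the balls of rational centre and radius
    1/(k+1) that it contains, of which there are countably many. *)
Lemma open_measurable_rV (U : set 'rV[R]_n) : open U -> measurable U.
Proof.
move=> oU.
pose B (z : 'rV[rat]_n * nat) : set 'rV[R]_n :=
  if `[< ball (map_mx ratr z.1 : 'rV[R]_n) z.2.+1%:R^-1 `<=` U >]
  then ball (map_mx ratr z.1 : 'rV[R]_n) z.2.+1%:R^-1 else set0.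
suff -> : U = \bigcup_z B z.
  apply: countable_bigcupT_measurable; first exact: countableP.
  by move=> z; rewrite /B; case: ifP => _ //; exact: measurable_ball_rV.
apply/seteqP; split=> [x Ux|x [z _]]; last first.
  by rewrite /B; case: asboolP => // sub /sub.
have /nbhs_ballP[e /= e0 eU] : nbhs x U by exact: open_nbhs_nbhs.
(* With 1/(k+1) at most e/2, a ball of that radius containing [x] stays inside [ball x e]. *)
pose k := Num.truncn (2 / e).
have ke : k.+1%:R^-1 <= e / 2.
  rewrite -[e / 2]invrK lef_pV2 ?posrE ?invr_gt0 ?divr_gt0 // invf_div.
  by apply: ltW; rewrite truncnS_gt.
have k0 : 0 < k.+1%:R^-1 :> R by rewrite invr_gt0.
have q i : {r : rat | `|x ord0 i - ratr r| < k.+1%:R^-1}.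
  apply: cid.
  have [r] := @rat_in_itvoo R (x ord0 i - k.+1%:R^-1) (x ord0 i + k.+1%:R^-1)
     ltac:(by rewrite ltrBlDr -addrA ltrDl addr_gt0).
  rewrite in_itv /= => /andP[r1 r2]; exists r.
  by rewrite distrC ltr_distl r1 r2.
exists (\row_i sval (q i), k) => //; rewrite /B /=.
have bx : ball (map_mx ratr (\row_i sval (q i)) : 'rV[R]_n) k.+1%:R^-1 x.
  apply/ball_rVP => // i; rewrite !mxE distrC; exact: (svalP (q i)).
case: asboolP => // -[]; apply: subset_trans eU => y yb.
apply: (@le_ball _ _ x (k.+1%:R^-1 + k.+1%:R^-1)).
  by rewrite [leRHS]splitr lerD.
by apply: ball_triangle yb; exact: ball_sym.
Qed.

Lemma closed_measurable_rV (F : set 'rV[R]_n) : closed F -> measurable F.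
Proof. by move=> /closed_openC/open_measurable_rV/measurableC; rewrite setCK. Qed.

Lemma compact_closed_rV (F : set 'rV[R]_n) : compact F -> closed F.
Proof. by apply: compact_closed; exact: norm_hausdorff. Qed.

Lemma compact_measurable_rV (F : set 'rV[R]_n) : compact F -> measurable F.
Proof. by move=> /compact_closed_rV/closed_measurable_rV. Qed.

Lemma continuous_measurable_rV (f : 'rV[R]_n -> R) (D : set 'rV[R]_n) :
  continuous f -> measurable_fun D f.
Proof.
move=> /continuousP cf; apply: measurable_funTS.
apply: (measurability _ (RGenOpens.measurableE R)).
move=> _ [_ [a [b ->] <-]]; rewrite setTI; apply: open_measurable_rV.
exact/cf/interval_open.
Qed.

End borel_rV.

(** * Volume of cubes, Fubini in the first coordinate, integrals of one-variable derivatives *)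

Section lebesgue_rV_theory.
Context {R : realType}.

Definition cube n (a : 'rV[R]_n) (l : R) : set 'rV[R]_n :=
  [set y | forall i, a ord0 i <= y ord0 i <= a ord0 i + l].

Lemma compact_cube n (a : 'rV[R]_n) l : compact (cube a l).
Proof.
have -> : cube a l = [set y : 'rV[R]_n | forall i,
    `[a ord0 i, a ord0 i + l]%classic (y ord0 i)].
  by apply/seteqP; split => y h i; move: (h i); rewrite /= in_itv.
apply: (@rV_compact _ n (fun i => `[a ord0 i, a ord0 i + l]%classic)) => i; exact: segment_compact.
Qed.

Lemma lebesgue_rVSE n (A : set 'rV[R]_n.+1) :
  lebesgue_rV n.+1 A =
  (@lebesgue_measure R \x lebesgue_rV n)%E (@cons_rV R n @^-1` A).
Proof. by []. Qed.

Lemma lebesgue_cube n (a : 'rV[R]_n) l : 0 <= l ->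
  lebesgue_rV n (cube a l) = (l ^+ n)%:E.
Proof.
move=> l0; elim: n a => [|n IH] a.
  rewrite /= diracE mem_set ?expr0 // => i; by case: i.
rewrite lebesgue_rVSE.
have -> : cons_rV (T:=R) (n:=n) @^-1` cube a l =
    `[a ord0 ord0, a ord0 ord0 + l]%classic `*` cube (uncons_rV a).2 l.
  apply/seteqP; split => [[t y] /= h|[t y] /= [h1 h2] i].
    split => /=.
      by have := h ord0; rewrite mxE unlift_none /= in_itv.
    by move=> i; have := h (lift ord0 i); rewrite !mxE liftK.
  rewrite mxE; case: unliftP => [j|] -> /=; last by move: h1; rewrite in_itv.
  by have := h2 j; rewrite !mxE.
rewrite product_measure1E //; last by apply: compact_measurable_rV; exact: compact_cube.
rewrite IH.
rewrite [X in (X * _)%E](lebesgue_measure_itv `[a ord0 ord0, a ord0 ord0 + l])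
  /= lte_fin ltrDl exprS.
have [l_gt0|l1] := ltP 0 l; last first.
  by have -> : l = 0; [apply/le_anti; rewrite l0 l1|rewrite mul0e mul0r].
by rewrite -EFinD addrAC subrr add0r -EFinM.
Qed.

Lemma bounded_rV_cube n (A : set 'rV[R]_n) : bounded_set A ->
  exists a l, 0 <= l /\ A `<=` cube a l.
Proof.
move=> [M [Mr AM]]; exists (const_mx (- (`|M| + 1))), (2 * (`|M| + 1)).
split=> [|x Ax i]; first by rewrite mulr_ge0 // addr_ge0.
have : `|x| <= `|M| + 1 by apply: AM => //; rewrite ltr_pwDr // ler_norm.
rewrite [X in X <= _]mx_normrE => /bigmax_leP[_ /(_ (ord0, i) isT)] /=.
by rewrite ler_norml mxE => /andP[h1 h2]; apply/andP; split => //; lra.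
Qed.

Lemma lebesgue_rV_bounded n (A : set 'rV[R]_n) : measurable A ->
  bounded_set A -> (lebesgue_rV n A < +oo)%E.
Proof.
move=> mA /bounded_rV_cube[a [l [l0 sub]]].
apply: le_lt_trans (le_measure _ _ _ sub) _; rewrite ?inE //.
  by apply: compact_measurable_rV; exact: compact_cube.
by rewrite [ltLHS]lebesgue_cube // ltry.
Qed.

Lemma integrable_bounded_cube n (g : 'rV[R]_n -> R) M a l : 0 <= l ->
  measurable_fun setT g -> (forall y, `|g y| <= M) ->
  (forall y, ~ cube a l y -> g y = 0) ->
  (lebesgue_rV n).-integrable setT (EFin \o g).
Proof.
move=> l0 mg gM g0.
have mc : measurable (cube a l).
  by apply: compact_measurable_rV; exact: compact_cube.
have -> : EFin \o g = (EFin \o g) \_ (cube a l).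
  apply/funext => y; rewrite patchE; case: ifPn => //.
  by rewrite notin_setE => /g0 /= ->.
apply/(integrable_mkcond _ mc).
apply: measurable_bounded_integrable => //.
- by rewrite [ltLHS]lebesgue_cube // ltry.
- exact: measurable_funTS.
- by exists M; split; [exact: num_real|move=> x Mx y _; exact: le_trans (gM y) (ltW Mx)].
Qed.

Let mcons n : measurable_fun [set: measurableTypeR R * 'rV[R]_n] (@cons_rV R n).
Proof. exact: measurable_cons_rV. Qed.

(** The same set function as [lebesgue_rV n.+1], carrying the measure structure of a pushforward,
    which is the form that change of variables expects. *)
Let pm n := measure_function_pushforward__canonical__measure_function_Measure
  (@lebesgue_measure R \x lebesgue_rV n)%E (@mcons n).

Let integral_rVS_pushforward n (g : 'rV[R]_n.+1 -> \bar R) :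
  (\int[lebesgue_rV n.+1]_x g x = \int[pm n]_x g x)%E.
Proof. exact: eq_measure_integral. Qed.

Lemma integrable_cons_rV n (g : 'rV[R]_n.+1 -> R) :
  (lebesgue_rV n.+1).-integrable setT (EFin \o g) ->
  (@lebesgue_measure R \x lebesgue_rV n)%E.-integrable setT
    (EFin \o g \o @cons_rV R n).
Proof.
move=> /integrableP[mg ig]; apply/integrableP; split.
  exact: (measurableT_comp mg (@mcons n)).
move: ig; rewrite integral_rVS_pushforward ge0_integral_pushforward //.
  exact: mcons.
exact: measurableT_comp.
Qed.

Lemma integral_rVS n (g : 'rV[R]_n.+1 -> R) :
  (lebesgue_rV n.+1).-integrable setT (EFin \o g) ->
  (\int[lebesgue_rV n.+1]_x (g x)%:E =
   \int[@lebesgue_measure R \x lebesgue_rV n]_z (g (cons_rV z))%:E)%E.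
Proof.
move=> ig; rewrite integral_rVS_pushforward.
have mg : measurable_fun setT (EFin \o g) by case/integrableP: ig.
have := integral_pushforward (@mcons n) mg (D := setT)
  (mu := (@lebesgue_measure R \x lebesgue_rV n)%E).
rewrite preimage_setT; apply => //; exact: integrable_cons_rV.
Qed.

Lemma integral_derive_eq0 (h : R -> R) (a l : R) : 0 <= l ->
  (forall x, derivable h x 1) -> continuous ('D_1 h) ->
  (forall x, ~~ (a <= x <= a + l) -> h x = 0) ->
  (\int[lebesgue_measure]_x ('D_1 h x)%:E = 0)%E.
Proof.
move=> l0 dh cdh h0.
have h'0 x : ~~ (a <= x <= a + l) -> 'D_1 h x = 0.
  move=> xn; rewrite (near_eq_derive _ (g := cst 0)) ?derive_cst //.
  have := xn; rewrite negb_and -!ltNge => /orP[xa|xa].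
    near=> z; rewrite h0 // negb_and -!ltNge; apply/orP; left; near: z.
    exact: lt_nbhsl.
  near=> z; rewrite h0 // negb_and -!ltNge; apply/orP; right; near: z.
  exact: lt_nbhsr.
(* One unit is added on each side: the endpoints lie strictly outside the support, so the boundary
   terms vanish, and the interval is nondegenerate even when [l = 0]. *)
transitivity (\int[lebesgue_measure]_(x in `[(a - 1)%R, (a + l + 1)%R]) ('D_1 h x)%:E)%E.
  rewrite [RHS]integral_mkcond; apply: eq_integral => x _; rewrite patchE.
  case: ifPn => // /negP xn; rewrite h'0 //; apply/negP => /andP[x1 x2].
  by apply: xn; rewrite inE /= in_itv /=; apply/andP; split; lra.
have dch : {in `]a - 1, a + l + 1[, forall x, derivable h x 1} by move=> x _.
have ch : continuous h.
  by move=> x; apply/differentiable_continuous/derivable1_diffP.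
rewrite (@continuous_FTC2 _ _ h).
- by rewrite !h0 ?subee //; apply/negP => /andP[]; lra.
- lra.
- exact: continuous_subspaceT.
- split => //; first exact/cvg_at_right_filter/ch.
  exact/cvg_at_left_filter/ch.
- by move=> x _; rewrite derive1E.
Unshelve. all: by end_near. Qed.

End lebesgue_rV_theory.


(** * Partial derivatives and the vanishing of their integrals *)

Section partial_derivatives.
Context {R : realType}.

Notation dir i := (delta_mx ord0 i : 'rV[R]_ _).

(* The difference quotients of f and g are literally the same functions. *)
Lemma derive_along n m (f : 'rV[R]_n -> R) (g : 'rV[R]_m -> R) x v y w :
  (forall h : R, f (h *: v + x) = g (h *: w + y)) ->
  'D_v f x = 'D_w g y /\ (derivable f x v <-> derivable g y w).
Proof.
move=> fg.
have E : (fun h : R => h^-1 *: ((f \o shift x) (h *: v) - f x)) =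
         (fun h => h^-1 *: ((g \o shift y) (h *: w) - g y)).
  apply/funext => h /=; rewrite fg.
  by have := fg 0; rewrite !scale0r !add0r => ->.
by rewrite /derive /derivable E.
Qed.

Lemma derive_coord n (f : 'rV[R]_n -> R) (g : R -> R) x i :
  (forall h : R, f (h *: dir i + x) = g (h + x ord0 i)) ->
  'D_(dir i) f x = 'D_1 g (x ord0 i) /\
  (derivable f x (dir i) <-> derivable g (x ord0 i) 1).
Proof.
move=> fg.
have E : (fun h : R => h^-1 *: ((f \o shift x) (h *: dir i) - f x)) =
   (fun h => h^-1 *: ((g \o shift (x ord0 i)) (h *: (1 : R)) - g (x ord0 i))).
  apply/funext => h /=; rewrite fg [h *: 1]mulr1.
  by have := fg 0; rewrite scale0r !add0r => ->.
by rewrite /derive /derivable E.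
Qed.

Lemma cons_rV_shift0 n (h t : R) (y : 'rV[R]_n) :
  h *: dir ord0 + cons_rV (t, y) = cons_rV (h + t, y).
Proof.
apply/rowP => j; rewrite !mxE eqxx /=; case: (unliftP ord0 j) => [k|] -> /=.
  by rewrite mulr0 add0r.
by rewrite mulr1.
Qed.

Lemma cons_rV_shiftS n i (h t : R) (y : 'rV[R]_n) :
  h *: dir (lift ord0 i) + cons_rV (t, y) = cons_rV (t, h *: dir i + y).
Proof.
apply/rowP => j; rewrite !mxE eqxx /=; case: (unliftP ord0 j) => [k|] -> /=.
  by rewrite !mxE eqxx /= (inj_eq lift_inj).
by rewrite mulr0 add0r.
Qed.

Lemma continuous_consr n (t : R) : continuous (fun y : 'rV[R]_n => cons_rV (t, y)).
Proof.
move=> y U /(nbhs_ballP (cons_rV (t, y)))[e /= e0 eU].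
apply/nbhs_ballP; exists e => // z /(ball_rVP _ _ e0) yz; apply: eU.
apply/ball_rVP => // i; rewrite !mxE; case: unlift => [j|]; first exact: yz.
by rewrite subrr normr0.
Qed.

Lemma continuous_consl n (y : 'rV[R]_n) : continuous (fun t : R => cons_rV (t, y)).
Proof.
move=> t U /(nbhs_ballP (cons_rV (t, y)))[e /= e0 eU].
apply/nbhs_ballP; exists e => // z tz; apply: eU.
by apply/ball_rVP => // i; rewrite !mxE; case: unlift => [j|//]; rewrite subrr normr0.
Qed.

Lemma compact_support_bounded n (g : 'rV[R]_n -> R) (K : set 'rV[R]_n) :
  compact K -> continuous g -> (forall y, ~ K y -> g y = 0) ->
  exists2 M, 0 <= M & forall y, `|g y| <= M.
Proof.
move=> cK cg g0.
have : compact (g @` K).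
  by apply: continuous_compact => //; exact: continuous_subspaceT.
move=> /compact_bounded[M [Mr HM]].
exists (`|M| + 1) => [|y]; first by rewrite addr_ge0.
have [Ky|/g0 ->] := pselect (K y); last by rewrite normr0 addr_ge0.
by apply: HM; [rewrite ltr_pwDr // ler_norm|exists y].
Qed.

Lemma derive_support n (g : 'rV[R]_n -> R) (K : set 'rV[R]_n) v :
  closed K -> (forall y, ~ K y -> g y = 0) ->
  forall y, ~ K y -> 'D_v g y = 0.
Proof.
move=> cK g0 y Ky; rewrite (near_eq_derive _ (g := cst 0)) ?derive_cst //.
have : nbhs y (~` K) by apply: open_nbhs_nbhs; split => //; exact: closed_openC.
by apply: filterS => z /g0.
Qed.

(** By Fubini. If the direction is the first coordinate, that variable is integrated first and the
    one-dimensional case applies; otherwise the first coordinate is frozen and the slice is handled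
    by induction on the dimension. *)
Lemma integral_partial_eq0 n (g : 'rV[R]_n -> R) i a l : 0 <= l ->
  (forall x, derivable g x (dir i)) -> continuous ('D_(dir i) g) ->
  (forall y, ~ cube a l y -> g y = 0) ->
  (\int[lebesgue_rV n]_x ('D_(dir i) g x)%:E = 0)%E.
Proof.
move=> l0; elim: n g i a => [|n IH] g i a; first by case: i.
move=> dg cdg g0.
have cc m (b : 'rV[R]_m) : closed (cube b l).
  by apply: compact_closed_rV; exact: compact_cube.
have [M M0 HM] := compact_support_bounded (@compact_cube _ _ a l) cdg
  (@derive_support _ _ _ _ (cc _ a) g0).
have ig : (lebesgue_rV n.+1).-integrable setT (EFin \o 'D_(dir i) g).
  apply: (@integrable_bounded_cube _ _ _ M a l) => //.
    exact: continuous_measurable_rV.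
  exact: derive_support.
have ig' := integrable_cons_rV ig.
rewrite integral_rVS //.
case: (unliftP ord0 i) => [j|] ij; rewrite {}ij in dg cdg HM ig ig' *.
  rewrite -(integral12_prod_meas1 ig') /fubini_F.
  apply: integral0_eq => t _ /=.
  have E y := @derive_along _ _ g (g \o (fun y => cons_rV (t, y))) (cons_rV (t, y))
     (dir (lift ord0 j)) y (dir j) (fun h => f_equal g (cons_rV_shiftS j h t y)).
  under eq_integral do rewrite (E _).1.
  apply: (IH _ _ (uncons_rV a).2).
  - by move=> y; exact: (proj1 (E y).2 (dg _)).
  - rewrite (_ : 'D_(dir j) _ = 'D_(dir (lift ord0 j)) g \o (fun y => cons_rV (t, y))).
      by move=> y; apply: continuous_comp; [exact: continuous_consr|exact: cdg].
    by apply/funext => y; rewrite -(E y).1.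
  - move=> y ya; apply: g0 => h; apply: ya => k.
    by have := h (lift ord0 k); rewrite !mxE liftK.
rewrite -(integral21_prod_meas1 ig') /fubini_G.
apply: integral0_eq => y _ /=.
have E t : 'D_(dir ord0) g (cons_rV (t, y)) = 'D_1 (fun t => g (cons_rV (t, y))) t /\
    (derivable g (cons_rV (t, y)) (dir ord0) <-> derivable (fun t => g (cons_rV (t, y))) t 1).
  have := @derive_coord _ g (fun t => g (cons_rV (t, y))) (cons_rV (t, y)) ord0.
  rewrite mxE unlift_none /=; apply => h; by rewrite cons_rV_shift0.
under eq_integral do rewrite (E _).1.
apply: (integral_derive_eq0 (a := a ord0 ord0) l0).
- by move=> x; exact: (proj1 (E x).2 (dg _)).
- rewrite (_ : 'D_1 (fun t : R => g (cons_rV (t, y))) = 'D_(dir ord0) g \o (fun t => cons_rV (t, y))).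
    by move=> t; apply: continuous_comp; [exact: continuous_consl|exact: cdg].
  by apply/funext => t; rewrite -(E t).1.
- move=> t ta; apply: g0 => h; move/negP: ta; apply.
  by have := h ord0; rewrite mxE unlift_none.
Qed.

End partial_derivatives.

(** * Test functions and weak derivatives *)

Section test_functions.
Context {R : realType} {n : nat}.
Local Notation mu := (@lebesgue_rV R n).
Local Notation dir i := (delta_mx ord0 i : 'rV[R]_n).
Implicit Types (D K : set 'rV[R]_n) (f g u v phi : 'rV[R]_n -> R).

Lemma continuous_mul f g : continuous f -> continuous g ->
  continuous (fun x => f x * g x).
Proof. by move=> cf cg x; exact: (continuousM (cf x) (cg x)). Qed.

Lemma continuous_add f g : continuous f -> continuous g ->
  continuous (fun x => f x + g x).
Proof. by move=> cf cg x; exact: (continuousD (cf x) (cg x)). Qed.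

Lemma iter_partial_cat s1 s2 phi :
  iter_partial (s1 ++ s2) phi = iter_partial s1 (iter_partial s2 phi).
Proof. by rewrite /iter_partial foldr_cat. Qed.

Lemma iter_partial_support K s phi : closed K ->
  (forall y, ~ K y -> phi y = 0) -> forall y, ~ K y -> iter_partial s phi y = 0.
Proof. by move=> cK phi0; elim: s => //= i s; exact: derive_support. Qed.

Lemma test_function_iter D s phi :
  test_function D phi -> test_function D (iter_partial s phi).
Proof.
move=> [smp [K [cK KD phi0]]]; split.
  by move=> s'; rewrite -iter_partial_cat; exact: smp.
exists K; split => //; apply: iter_partial_support => //.
exact: compact_closed_rV.
Qed.

Lemma test_function_sub D D' phi : D `<=` D' ->
  test_function D phi -> test_function D' phi.
Proof.
move=> DD' [smp [K [cK KD phi0]]]; split => //.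
by exists K; split => //; exact: subset_trans DD'.
Qed.

Lemma test_function_continuous D phi : test_function D phi -> continuous phi.
Proof. by move=> [smp _]; case: (smp [::]). Qed.

Lemma test_function_bounded D phi : test_function D phi ->
  exists2 M, 0 <= M & forall y, `|phi y| <= M.
Proof.
move=> tp; have cphi := test_function_continuous tp.
by case: tp => _ [K [cK _ phi0]]; exact: compact_support_bounded phi0.
Qed.

Lemma integral_support D K (h : 'rV[R]_n -> \bar R) : K `<=` D ->
  (forall y, D y -> ~ K y -> h y = 0%E) ->
  (\int[mu]_(x in D) h x = \int[mu]_(x in K) h x)%E.
Proof.
move=> KD h0; rewrite integral_mkcond [RHS]integral_mkcond.
apply: eq_integral => x _; rewrite !patchE.
have [Kx|Kx] := pselect (K x); first by rewrite !mem_set //; exact: KD.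
rewrite (memNset Kx); case: ifPn => // /set_mem Dx; exact: h0.
Qed.

Lemma Rintegral_test D D' f phi : D' `<=` D -> test_function D' phi ->
  \int[mu]_(x in D) (f x * phi x) = \int[mu]_(x in D') (f x * phi x).
Proof.
move=> D'D [_ [K [_ KD' phi0]]]; rewrite /Rintegral; congr fine.
rewrite (@integral_support D K); last 2 first.
- exact: subset_trans D'D.
- by move=> y _ /phi0 ->; rewrite mulr0.
rewrite (@integral_support D' K) // => y _ /phi0 ->; by rewrite mulr0.
Qed.

Lemma loc_integrable_test D f phi : open D -> loc_integrable D f ->
  test_function D phi -> mu.-integrable D (EFin \o (fun x => f x * phi x)).
Proof.
move=> oD [mf fK] tphi.
have [M M0 phiM] := test_function_bounded tphi.
have mD := open_measurable_rV oD.
have mphi : measurable_fun D phi.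
  by apply: continuous_measurable_rV; exact: test_function_continuous tphi.
case: tphi => _ [K [cK KD phi0]].
have mK := compact_measurable_rV cK.
have mfK : measurable_fun K f by exact: measurable_funS mf.
have mphiK : measurable_fun K phi by exact: measurable_funS mphi.
apply/integrableP; split; first by apply/measurable_EFinP/measurable_funM.
rewrite (@integral_support D K) //; last first.
  by move=> y _ /phi0 /= ->; rewrite mulr0 normr0.
apply: (@le_lt_trans _ _ (\int[mu]_(x in K) (M%:E * `|f x|%:E))%E); last first.
  rewrite ge0_integralZl //; first by rewrite lte_mul_pinfty // fK.
  by apply/measurable_EFinP; exact: measurableT_comp.
apply: ge0_le_integral => //.
- by apply: measurableT_comp => //; apply/measurable_EFinP; exact: measurable_funM.
- apply: measurable_funeM; apply/measurable_EFinP; exact: measurableT_comp.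
- by move=> x _ /=; rewrite -EFinM lee_fin normrM mulrC ler_wpM2r.
Qed.

Lemma continuous_loc_integrable D f : continuous f -> loc_integrable D f.
Proof.
move=> cf; split; first exact: continuous_measurable_rV.
move=> K _ cK.
have : compact (f @` K).
  by apply: continuous_compact => //; exact: continuous_subspaceT.
move=> /compact_bounded[M [Mr HM]].
have mK := compact_measurable_rV cK.
have muK : (mu K < +oo)%E.
  by apply: lebesgue_rV_bounded => //; exact: compact_bounded.
apply: (@le_lt_trans _ _ (\int[mu]_(x in K) (`|M| + 1)%:E)%E); last first.
  by rewrite integral_cst // lte_mul_pinfty // lee_fin addr_ge0.
apply: ge0_le_integral => //.
- apply/measurable_EFinP/measurableT_comp => //; exact: continuous_measurable_rV.
- move=> x Kx; rewrite lee_fin; apply: HM; last by exists x.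
  by rewrite ltr_pwDr // ler_norm.
Qed.

Lemma loc_integrable_sub D D' f : open D -> open D' -> D' `<=` D ->
  loc_integrable D f -> loc_integrable D' f.
Proof.
move=> oD oD' D'D [mf fK]; split.
  by apply: measurable_funS mf => //; exact: open_measurable_rV.
by move=> K KD' cK; apply: fK => //; exact: subset_trans D'D.
Qed.

Lemma loc_integrableB D f g : open D ->
  loc_integrable D f -> loc_integrable D g -> loc_integrable D (f \- g).
Proof.
move=> oD [mf fK] [mg gK]; split; first exact: measurable_funB.
move=> K KD cK; have mK := compact_measurable_rV cK.
have mD := open_measurable_rV oD.
have mfK : measurable_fun K f by exact: measurable_funS mf.
have mgK : measurable_fun K g by exact: measurable_funS mg.
apply: (@le_lt_trans _ _ (\int[mu]_(x in K) (`|f x|%:E + `|g x|%:E))%E).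
  apply: ge0_le_integral => //.
  - by apply/measurable_EFinP/measurableT_comp => //; exact: measurable_funB.
  - by apply: emeasurable_funD; apply/measurable_EFinP/measurableT_comp.
  - by move=> x _; rewrite -EFinD lee_fin ler_normB.
rewrite ge0_integralD //; last 2 first.
- by apply/measurable_EFinP/measurableT_comp.
- by apply/measurable_EFinP/measurableT_comp.
by rewrite lte_add_pinfty ?fK ?gK.
Qed.

Lemma is_weak_deriv_sub D D' alpha u v : open D -> open D' -> D' `<=` D ->
  is_weak_deriv D alpha u v -> is_weak_deriv D' alpha u v.
Proof.
move=> oD oD' D'D [lu lv H]; split; [exact: loc_integrable_sub lu|exact: loc_integrable_sub lv|].
move=> phi tphi; have := H _ (test_function_sub D'D tphi).
by rewrite !(Rintegral_test _ D'D) //; exact: test_function_iter.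
Qed.

Lemma is_weak_derivB D alpha u1 v1 u2 v2 : open D ->
  is_weak_deriv D alpha u1 v1 -> is_weak_deriv D alpha u2 v2 ->
  is_weak_deriv D alpha (u1 \- u2) (v1 \- v2).
Proof.
move=> oD [lu1 lv1 H1] [lu2 lv2 H2]; split; [exact: loc_integrableB|exact: loc_integrableB|].
have mD := open_measurable_rV oD.
have L f g phi : test_function D phi -> loc_integrable D f -> loc_integrable D g ->
    \int[mu]_(x in D) ((f \- g) x * phi x) =
    \int[mu]_(x in D) (f x * phi x) - \int[mu]_(x in D) (g x * phi x).
  move=> tphi lf lg; rewrite -RintegralB //; [|exact: loc_integrable_test..].
  by apply: eq_Rintegral => x _; rewrite /= mulrBl.
move=> phi tphi; rewrite !L //; last exact: test_function_iter.
by rewrite H1 // H2 // mulrBr.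
Qed.

Lemma eq_is_weak_deriv D alpha u u' v : open D -> {in D, u =1 u'} ->
  is_weak_deriv D alpha u v -> is_weak_deriv D alpha u' v.
Proof.
move=> oD uu' [[mu_ uK] lv H]; split => //; first split.
- exact: eq_measurable_fun mu_.
- move=> K KD cK; rewrite (eq_integral (fun x => `|u x|%:E)); first exact: uK.
  by move=> x /set_mem Kx; rewrite uu' //; apply: mem_set; exact: KD.
- move=> phi tphi; rewrite -(H phi tphi); apply: eq_Rintegral => x Dx.
  by rewrite uu'.
Qed.

(** The product [f * phi] vanishes outside a cube, so the integral of its partial derivative is
    zero. *)
Lemma integration_by_parts_rV f phi i : continuous f ->
  (forall x, derivable f x (dir i)) -> continuous ('D_(dir i) f) ->
  test_function setT phi ->
  \int[mu]_x (f x * 'D_(dir i) phi x) = - \int[mu]_x ('D_(dir i) f x * phi x).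
Proof.
move=> cf df cdf tphi.
have tdphi : test_function setT ('D_(dir i) phi) by exact: (@test_function_iter _ [:: i]).
have dphi x : derivable phi x (dir i) by case: tphi => sm _; exact: (sm [::]).2.
pose g : 'rV[R]_n -> R := f * phi.
have E x : 'D_(dir i) g x = f x * 'D_(dir i) phi x + 'D_(dir i) f x * phi x.
  by rewrite deriveM // [in RHS](mulrC ('D_(dir i) f x)).
have i1 := loc_integrable_test openT (continuous_loc_integrable setT cf) tdphi.
have i2 := loc_integrable_test openT (continuous_loc_integrable setT cdf) tphi.
apply/eqP; rewrite -addr_eq0 -RintegralD //.
case: (tphi) => _ [K [cK _ phi0]].
have [a [l [l0 Ka]]] := bounded_rV_cube (compact_bounded cK).
apply/eqP; transitivity (fine (\int[mu]_x ('D_(dir i) g x)%:E)%E).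
  by congr fine; apply: eq_integral => x _; rewrite E.
suff -> : (\int[mu]_x ('D_(dir i) g x)%:E = 0)%E by [].
apply: (integral_partial_eq0 l0).
- by move=> x; exact: derivableM.
- have -> : 'D_(dir i) g = fun x => f x * 'D_(dir i) phi x + 'D_(dir i) f x * phi x.
    by apply/funext => x; exact: E.
  apply: continuous_add.
    by apply: (continuous_mul cf); exact: test_function_continuous tdphi.
  by apply: (continuous_mul cdf); exact: test_function_continuous tphi.
- move=> y /(contra_not (Ka y)) /phi0 e.
  have e' : f y * phi y = 0 by rewrite e mulr0.
  exact: e'.
Qed.

End test_functions.

(** * Polynomials *)

Section polynomials.
Context {R : realType} {n : nat}.
Local Notation mu := (@lebesgue_rV R n).
Local Notation dir i := (delta_mx ord0 i : 'rV[R]_n).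
Implicit Types (f g phi : 'rV[R]_n -> R).

(** The only facts about polynomials of degree less than [N] that integration by parts uses: all
    iterated partials of order [N] are zero, and those of lower order exist and are continuous. One
    partial derivative lowers [N] by one, which suits an induction on the list of directions. *)
Fixpoint partials_vanish N f : Prop :=
  if N is N'.+1 then continuous f /\
    forall i, (forall x, derivable f x (dir i)) /\ partials_vanish N' ('D_(dir i) f)
  else forall x, f x = 0.

Lemma partials_vanish_ext N f g : f =1 g -> partials_vanish N f -> partials_vanish N g.
Proof. by move=> /funext ->. Qed.

Lemma partials_vanish0 N : partials_vanish N (fun=> 0).
Proof.
elim: N => //= N IH; split=> [x|i]; first exact: cst_continuous.
split=> [x|]; first exact: derivable_cst.
by apply: partials_vanish_ext IH => x; rewrite derive_cst.
Qed.

Lemma partials_vanish_le N N' f : (N <= N')%N ->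
  partials_vanish N f -> partials_vanish N' f.
Proof.
elim: N N' f => [|N IH] [|N'] f //.
  by move=> _ f0; apply: partials_vanish_ext (partials_vanish0 _).
rewrite ltnS => NN' [cf df]; split => // i; split; first exact: (df i).1.
exact: IH (df i).2.
Qed.

Lemma partials_vanishD N f g : partials_vanish N f -> partials_vanish N g ->
  partials_vanish N (fun x => f x + g x).
Proof.
elim: N f g => [|N IH] f g; first by move=> f0 g0 x; rewrite f0 g0 addr0.
move=> [cf df] [cg dg]; split; first exact: continuous_add.
move=> i; have [dfi pf] := df i; have [dgi pg] := dg i; split.
  by move=> x; exact: derivableD.
by apply: partials_vanish_ext (IH _ _ pf pg) => x; rewrite [RHS]deriveD.
Qed.

Lemma partials_vanishZ N (c : R) f : partials_vanish N f ->
  partials_vanish N (fun x => c * f x).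
Proof.
elim: N f => [|N IH] f; first by move=> f0 x; rewrite f0 mulr0.
move=> [cf df]; split.
  by apply: continuous_mul => // x; exact: cst_continuous.
move=> i; have [dfi pf] := df i; split; first by move=> x; exact: derivableZ.
by apply: partials_vanish_ext (IH _ pf) => x; rewrite [RHS]deriveZ.
Qed.

Definition monomial (al : mindex n) (x : 'rV[R]_n) : R :=
  \prod_(i < n) x ord0 i ^+ al i.

Lemma continuous_prod_coord (h : 'I_n -> R -> R) : (forall i, continuous (h i)) ->
  continuous (fun x : 'rV[R]_n => \prod_(i < n) h i (x ord0 i)).
Proof.
move=> ch; rewrite /index_enum; elim: (Finite.enum _) => [|i s IH].
  by under eq_fun do rewrite big_nil; move=> x; exact: cst_continuous.
under eq_fun do rewrite big_cons; apply: continuous_mul => // x.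
by apply: (@continuous_comp _ _ _ (fun x : 'rV[R]_n => x ord0 i) (h i));
  [exact: coord_continuous|exact: ch].
Qed.

(* Only the i-th factor of a product of one-variable functions moves along dir i. *)
Lemma derive_prod_coord (h : 'I_n -> R -> R) (x : 'rV[R]_n) i :
  derivable (h i) (x ord0 i) 1 ->
  derivable (fun y : 'rV[R]_n => \prod_(j < n) h j (y ord0 j)) x (dir i) /\
  'D_(dir i) (fun y : 'rV[R]_n => \prod_(j < n) h j (y ord0 j)) x =
    \prod_(j < n) (if j == i then 'D_1 (h i) (x ord0 j) else h j (x ord0 j)).
Proof.
move=> dh; pose C := \prod_(j < n | j != i) h j (x ord0 j).
have := @derive_coord _ n (fun y => \prod_(j < n) h j (y ord0 j))
  (fun t => C * h i t) x i.
case=> [t|-> ->].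
  rewrite (bigD1 i) //= !mxE !eqxx mulr1 mulrC; congr (_ * _).
  by apply: eq_bigr => j ji; rewrite !mxE eqxx (negbTE ji) mulr0 add0r.
split; first exact: derivableZ.
rewrite (_ : (fun t => C * h i t) = C *: h i) // deriveZ //.
rewrite [RHS](bigD1 i) //= eqxx mulrC; congr (_ * _).
by apply: eq_bigr => j /negbTE ->.
Qed.

Lemma partials_vanish_monomial al : partials_vanish (mi_order al).+1 (monomial al).
Proof.
have [k] := ubnP (mi_order al); elim: k al => // k IH al; rewrite ltnS => alk.
have cpow j : continuous (fun t : R => t ^+ j) by move=> t; exact: exprn_continuous.
split=> [|i]; first exact: (continuous_prod_coord (h := fun i t => t ^+ al i)).
have dpow j (t : R) : derivable (fun t : R => t ^+ j) t 1 by exact: exprn_derivable.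
have D x := @derive_prod_coord (fun j t => t ^+ al j) x i (dpow _ _).
split; first by move=> x; exact: (D x).1.
(* If [al i = 0] the truncated predecessor leaves [al] unchanged, which is harmless since the factor
   [(al i)%:R] is then zero. *)
pose al' : mindex n := [ffun j => if j == i then (al j).-1 else al j].
have E x : 'D_(dir i) (monomial al) x = (al i)%:R * monomial al' x.
  rewrite (D x).2 /monomial !(bigD1 i (P := xpredT)) //= eqxx ffunE eqxx.
  rewrite -derive1E exp_derive1 mulrA -mulr_natl; congr (_ * _).
  by apply: eq_bigr => j ji; rewrite ffunE (negbTE ji).
have [ali0|ali] := posnP (al i).
  by apply: partials_vanish_ext (partials_vanish0 _) => x; rewrite E ali0 mul0r.
have al'E : mi_order al = (mi_order al').+1.
  rewrite /mi_order !(bigD1 i (P := xpredT)) //= ffunE eqxx -addSn prednK //.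
  by congr (_ + _)%N; apply: eq_bigr => j ji; rewrite ffunE (negbTE ji).
rewrite al'E; apply: (@partials_vanish_ext _ (fun x => (al i)%:R * monomial al' x)).
  by move=> x; rewrite E.
by apply/partials_vanishZ/IH; rewrite -al'E.
Qed.

Lemma finite_mi_order N : finite_set [set al : mindex n | (mi_order al <= N)%N].
Proof.
pose F (g : {ffun 'I_n -> 'I_N.+1}) : mindex n := [ffun i => val (g i)].
apply: (@sub_finite_set _ _ (F @` setT)); last exact/finite_image/finite_finset.
move=> al /= alN; exists [ffun i => inord (al i)] => //.
apply/ffunP => i; rewrite !ffunE /= inordK // ltnS (leq_trans _ alN) //.
by rewrite /mi_order (bigD1 i) //= leq_addr.
Qed.

Lemma partials_vanish_poly N P : is_poly_deg_lt N P -> partials_vanish N P.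
Proof.
move=> [c cP].
have fin : finite_set [set al : mindex n | (mi_order al < N)%N].
  by apply: sub_finite_set (finite_mi_order N) => al /= /ltnW.
pose s := finmap.enum_fset (fset_set [set al : mindex n | (mi_order al < N)%N]).
suff : partials_vanish N (fun x => \sum_(al <- s) c al * monomial al x).
  by apply: partials_vanish_ext => x; rewrite cP fsbig_finite.
have : {subset s <= [pred al : mindex n | (mi_order al < N)%N]}.
  by move=> al; rewrite /s in_fset_set // inE.
elim: (s : seq _) => [|al s' IH] sub.
  by apply: partials_vanish_ext (partials_vanish0 _) => x; rewrite big_nil.
under eq_fun do rewrite big_cons.
apply: partials_vanishD; last by apply: IH => b bs; apply: sub; rewrite inE bs orbT.
apply: partials_vanishZ; apply: partials_vanish_le (partials_vanish_monomial al).
by apply: (sub al); rewrite inE eqxx.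
Qed.

(** The partials move from [phi] to [f] one at a time and [W] is the resulting derivative of [f].
    They land on [f] in reverse order; an existential [W] avoids comparing the two orders. *)
Lemma partials_vanish_ibp N f s : partials_vanish N f ->
  exists W : 'rV[R]_n -> R, [/\ continuous W, (N <= size s)%N -> forall x, W x = 0 &
    forall phi, test_function setT phi ->
      \int[mu]_x (f x * iter_partial s phi x) =
      (-1) ^+ size s * \int[mu]_x (W x * phi x)].
Proof.
elim: s N f => [|i s IH] [|N] f.
- move=> f0; exists (fun=> 0); split => //; first by move=> x; exact: cst_continuous.
  by move=> phi _; rewrite expr0 mul1r; apply: eq_Rintegral => x _; rewrite f0.
- by move=> [cf _]; exists f; split => // phi _; rewrite expr0 mul1r.
- move=> f0; exists (fun=> 0); split => //; first by move=> x; exact: cst_continuous.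
  move=> phi _; rewrite (@eq_Rintegral _ _ _ _ _ (fun=> 0)); last first.
    by move=> x _; rewrite f0 mul0r.
  rewrite (@eq_Rintegral _ _ _ _ _ (fun=> 0) (fun x => 0 * phi x)); last first.
    by move=> x _; rewrite mul0r.
  by rewrite /Rintegral integral0 mulr0.
- move=> [cf /(_ i)[df pf]]; have [W [cW W0 HW]] := IH _ _ pf.
  exists W; split => // phi tphi.
  have cdf : continuous ('D_(dir i) f).
    case: N pf {W0} => [/funext ->|N []//] x; exact: cst_continuous.
  transitivity (- \int[mu]_x ('D_(dir i) f x * iter_partial s phi x)).
    exact: integration_by_parts_rV cf df cdf (test_function_iter s tphi).
  by rewrite HW // /= exprS mulN1r mulNr.
Qed.

End polynomials.


(** * Multi-indices as lists of directions *)

Section multi_indices.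
Context {n : nat}.
Implicit Types (al be : mindex n).

(** The list along which [cderiv al] differentiates, so that [cderiv al] unfolds to
    [iter_partial (mi_seq al)]. *)
Definition mi_seq al : seq 'I_n := flatten [seq nseq (al i) i | i <- enum 'I_n].

Lemma size_mi_seq al : size (mi_seq al) = mi_order al.
Proof.
rewrite size_flatten /shape -map_comp sumnE big_map big_enum /=.
by apply: eq_bigr => i _; rewrite size_nseq.
Qed.

(** The list consists of consecutive blocks, one per direction, so each prefix is again the list of
    a multi-index. Cutting the list of gamma at length j thus produces the beta of the splitting. *)
Lemma mi_seq_take al j : (j <= mi_order al)%N ->
  exists2 be, mi_order be = j & mi_seq be = take j (mi_seq al).
Proof.
move=> jal; suff [be beE] : exists be, mi_seq be = take j (mi_seq al).
  by exists be => //; rewrite -size_mi_seq beE size_takel // size_mi_seq.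
rewrite /mi_seq; have := enum_uniq 'I_n.
elim: (enum _) j {jal} => [|i e IH] j /=; first by exists al.
move=> /andP[ie ue]; have [jali|alij] := leqP j (al i).
  (* The cut falls inside the block of [i]: this block is shortened and all later ones become
     empty. *)
  exists [ffun k => if k == i then j else 0%N].
  rewrite ffunE eqxx takel_cat ?size_nseq // take_nseq //.
  rewrite (_ : flatten _ = [::]) ?cats0 //; apply/nilP; rewrite /nilp size_flatten.
  rewrite /shape -map_comp sumnE big_map big_seq big1 //= => k ke.
  by rewrite ffunE size_nseq; case: eqVneq => // ki; rewrite -ki ke in ie.
have [be beE] := IH (j - al i)%N ue.
(* The direction [i] does not occur in [e], so setting the value at [i] leaves the blocks of [e]
   unchanged. *)
exists [ffun k => if k == i then al i else be k].
rewrite ffunE eqxx take_cat size_nseq ltnNge (ltnW alij) /= -beE.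
congr (_ ++ flatten _); apply/eq_in_map => k ke; rewrite ffunE.
by case: eqVneq => // ki; rewrite -ki ke in ie.
Qed.

End multi_indices.

(** * Weak derivatives of the error on one element *)

Section error_weak_derivatives.
Context {R : realType} {n : nat}.
Local Notation mu := (@lebesgue_rV R n).
Implicit Types (D G : set 'rV[R]_n) (f u v w uh P phi : 'rV[R]_n -> R).

Lemma is_weak_deriv_poly D al N P : open D -> is_poly_deg_lt N P ->
  exists2 W, is_weak_deriv D al P W & (N <= mi_order al)%N -> forall x, W x = 0.
Proof.
move=> oD /partials_vanish_poly pP.
have [W [cW W0 HW]] := partials_vanish_ibp (mi_seq al) pP.
rewrite size_mi_seq in W0 HW; exists W => //; split.
- apply: continuous_loc_integrable.
  by case: N pP {W0} => [/funext -> x|N [] //]; exact: cst_continuous.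
- exact: continuous_loc_integrable.
- move=> phi tphi; have sub := @subsetT _ D.
  rewrite -(Rintegral_test _ sub tphi) -HW; last exact: test_function_sub tphi.
  by rewrite (Rintegral_test _ sub) //; exact: test_function_iter.
Qed.

Lemma wderivP D al u : (exists v, is_weak_deriv D al u v) ->
  is_weak_deriv D al u (wderiv D al u).
Proof. by move=> ex; exact: (@xgetPex _ (fun=> 0) [set v | is_weak_deriv D al u v] ex). Qed.

(** Here [D] is to be the interior of an element, where the discrete solution is the polynomial [P].
    The integral of [(u - uh) * D^gamma phi] is evaluated twice, with all [r] partials moved onto
    the error and with only [j] of them moved. *)
Lemma error_weak_deriv D G r gamma u w uh P j :
  open D -> open G -> D `<=` G -> mi_order gamma = r ->
  (forall al, (mi_order al <= r)%N -> exists v, is_weak_deriv G al u v) ->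
  is_weak_deriv G gamma u w -> is_poly_deg_lt r P ->
  (forall x, D x -> uh x = P x) -> (j <= r)%N ->
  exists be s, [/\ mi_order be = j, size s = (r - j)%N,
    loc_integrable D (wderiv D be (u \- uh)) &
    forall phi, test_function D phi ->
      `|\int[mu]_(x in G) (w x * phi x)| =
      `|\int[mu]_(x in D) (wderiv D be (u \- uh) x * iter_partial s phi x)| ].
Proof.
move=> oD oG DG gr uG uw polP uhP jr.
have exD al : (mi_order al <= r)%N -> exists v, is_weak_deriv D al (u \- uh) v.
  move=> alr; have [v uv] := uG _ alr.
  have [W PW _] := is_weak_deriv_poly al oD polP.
  exists (v \- W); apply: (@eq_is_weak_deriv _ _ _ _ (u \- P)) => //.
    by move=> x /set_mem Dx /=; rewrite uhP.
  by apply: is_weak_derivB => //; exact: is_weak_deriv_sub uv.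
have errw : is_weak_deriv D gamma (u \- uh) w.
  have [W PW W0] := is_weak_deriv_poly gamma oD polP.
  (* The derivative [W] of [P] has order [r], above the degree of [P], so it vanishes and [w] is
     also the derivative of the error. *)
  have -> : w = w \- W.
    by apply/funext => x; rewrite /= W0 ?subr0 // gr.
  apply: (@eq_is_weak_deriv _ _ _ _ (u \- P)) => //.
    by move=> x /set_mem Dx /=; rewrite uhP.
  by apply: is_weak_derivB => //; exact: is_weak_deriv_sub uw.
have [be bej beE] := @mi_seq_take _ gamma j ltac:(by rewrite gr).
have wbe := wderivP (exD be ltac:(by rewrite bej)).
exists be, (drop j (mi_seq gamma)); split => //.
- by rewrite size_drop size_mi_seq gr.
- by case: wbe.
move=> phi tphi; set s := drop j _.
(* The derivative of order [be] is tested against [iter_partial s phi]; together with the definition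
   for [gamma] and [phi] this gives the same left-hand side, and absolute values discard the
   signs. *)
have [_ _ /(_ _ (test_function_iter s tphi))] := wbe.
have [_ _ /(_ _ tphi)] := errw.
rewrite /cderiv -/(mi_seq gamma) -/(mi_seq be) -iter_partial_cat beE cat_take_drop.
move=> -> E; rewrite (Rintegral_test _ DG tphi).
have := f_equal Num.norm E; rewrite !normrM !normrX normrN1 !expr1n !mul1r.
by [].
Qed.

End error_weak_derivatives.

(** * Bump functions *)

Section bump.
Context {R : realType}.

(** The powers t^(-k) make the family closed under differentiation: the derivative of [flat k] is
    [flat k.+2 - k * flat k.+1]. *)
Definition flat (k : nat) (t : R) : R :=
  if 0 < t then t^-1 ^+ k * expR (- t^-1) else 0.

(** The inequality y/N <= exp(y/N), raised to the power N. *)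
Lemma exprn_expRN_le (N : nat) (y : R) : 0 <= y -> (0 < N)%N ->
  y ^+ N * expR (- y) <= N%:R ^+ N.
Proof.
move=> y0 N0; have N0' : 0 < N%:R :> R by rewrite ltr0n.
rewrite expRN ler_pdivrMr ?expR_gt0 //.
have -> : y = N%:R * (y / N%:R) by rewrite mulrC divfK // gt_eqF.
rewrite expRM_natl exprMn ler_wpM2l ?exprn_ge0 ?ler0n //.
rewrite lerXn2r ?nnegrE ?divr_ge0 ?expR_ge0 ?ler0n //.
by rewrite (le_trans _ (expR_ge1Dx _)) // lerDr.
Qed.

(** Two powers of 1/t are borrowed and the rest is bounded by the previous lemma at y = 1/t. A
    quadratic bound is what makes the derivative at the origin exist and be zero. *)
Lemma flat_sqr_bound k (t : R) : `|flat k t| <= k.+2%:R ^+ k.+2 * t ^+ 2.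
Proof.
rewrite /flat; case: ifPn => [t0|_]; last first.
  by rewrite normr0 mulr_ge0 ?sqr_ge0 ?exprn_ge0 ?ler0n.
rewrite ger0_norm ?mulr_ge0 ?exprn_ge0 ?expR_ge0 ?invr_ge0 ?(ltW t0) //.
have -> : t^-1 ^+ k * expR (- t^-1) = t^-1 ^+ k.+2 * expR (- t^-1) * t ^+ 2.
  have tt : t^-1 ^+ 2 * t ^+ 2 = 1 by rewrite -exprMn mulVf ?gt_eqF // expr1n.
  by rewrite -addn2 exprD -[LHS]mulr1 -tt; ring.
rewrite ler_wpM2r ?sqr_ge0 //; apply: exprn_expRN_le => //.
by rewrite invr_ge0 ltW.
Qed.

Lemma is_derive_quadratic0 (f : R -> R) (C : R) :
  (forall t, `|f t| <= C * t ^+ 2) -> is_derive (0 : R) 1 f 0.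
Proof.
move=> fC; have f0 : f 0 = 0.
  by apply/eqP; rewrite -normr_le0 (le_trans (fC 0)) // expr0n mulr0.
suff H : (fun h => h^-1 *: ((f \o shift (0 : R)) (h *: (1 : R)) - f 0)) @ 0^' --> (0 : R).
  by apply: DeriveDef; [apply/cvg_ex; exists 0 | exact: cvg_lim H].
apply: norm_cvg0; apply: (@squeeze_cvgr _ _ _ _ (fun=> 0) (fun h : R => C * `|h|)).
- near=> h; rewrite normr_ge0 /= addr0 f0 subr0 [h *: 1]mulr1 normrZ normfV.
  have h0 : h != 0 by near: h; exact: nbhs_dnbhs_neq.
  rewrite mulrC ler_pdivrMr ?normr_gt0 // (le_trans (fC h)) //.
  by rewrite -mulrA -normrM -expr2 ger0_norm ?sqr_ge0.
- exact: cvg_cst.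
- rewrite -[X in _ --> X](mulr0 C); apply: cvgM; first exact: cvg_cst.
  rewrite -[X in _ --> X](@normr0 _ R); apply: cvg_norm; exact: cvg_within.
Unshelve. all: by end_near. Qed.

Lemma is_derive_flat k (t : R) :
  is_derive t 1 (flat k) (flat k.+2 t - k%:R * flat k.+1 t).
Proof.
have [t0|t0|->] := ltgtP t 0; last first.
- rewrite /flat ltxx mulr0 subr0; exact: is_derive_quadratic0 (flat_sqr_bound k).
- pose g (s : R) : R := s^-1 ^+ k * expR (- s^-1).
  have gd : is_derive t 1 g (flat k.+2 t - k%:R * flat k.+1 t).
    have tN0 : t != 0 by rewrite gt_eqF.
    have i1 : is_derive t 1 (fun s : R => s^-1) (- t ^- 2 *: 1) by exact: is_deriveV.
    have gE : g = (fun s => s^-1) ^+ k * (expR \o (- (fun s : R => s^-1))).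
      by apply/funext => s; rewrite /g !fctE.
    rewrite gE; apply: is_derive_eq; rewrite /flat t0 /= !fctE /GRing.scale /=.
    rewrite -!exprVn; set y := t^-1; set e := expR _.
    by case: (k) => [|k'] /=; rewrite ?mul0r !exprS; ring.
  apply: near_eq_is_derive gd; near=> s; rewrite /flat ifT //; near: s.
  exact: lt_nbhsr.
- have -> : flat k.+2 t - k%:R * flat k.+1 t = 0.
    by rewrite /flat !(lt_gtF t0) mulr0 subr0.
  apply: (@near_eq_is_derive R R R (cst 0)).
  near=> s; rewrite /flat ifF //; apply/lt_gtF; near: s; exact: lt_nbhsl.
Unshelve. all: by end_near. Qed.

(** Linear combinations of products [flat k t * flat l (1 - t)]. The class is stable under
    differentiation and its members vanish outside the open unit interval, so smoothness and support
    of the bump are obtained for all orders at once. *)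
Inductive bump_class : (R -> R) -> Prop :=
| bump_prod c k l : bump_class (fun t => c * (flat k t * flat l (1 - t)))
| bump_add f g : bump_class f -> bump_class g -> bump_class (fun t => f t + g t).

Lemma bump_class_derive f : bump_class f ->
  exists2 f', bump_class f' & forall t : R, is_derive t 1 f (f' t).
Proof.
elim=> [c k l|g1 g2 _ [g1' b1 d1] _ [g2' b2 d2]]; last first.
  exists (fun t => g1' t + g2' t); first exact: bump_add.
  by move=> t; exact: is_deriveD.
exists (fun t => (c * (flat k.+2 t * flat l (1 - t)) +
    (- c * k%:R) * (flat k.+1 t * flat l (1 - t))) +
    ((- c) * (flat k t * flat l.+2 (1 - t)) +
    (c * l%:R) * (flat k t * flat l.+1 (1 - t)))).
  by apply: bump_add; apply: bump_add; exact: bump_prod.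
move=> t; have d1 := is_derive_flat k t.
have d2 : is_derive t 1 (fun s : R => 1 - s) (-1).
  by apply: is_derive_eq; rewrite add0r mul1r.
have d3 := @is_derive1_comp R (flat l) (fun s => 1 - s) t _ _ (is_derive_flat l (1 - t)) d2.
have -> : (fun t => c * (flat k t * flat l (1 - t))) =
    c *: (flat k * (flat l \o (fun s => 1 - s))) by [].
apply: is_derive_eq; rewrite /GRing.scale /=; ring.
Qed.

Lemma bump_class_out f (t : R) : bump_class f -> ~~ (0 < t < 1) -> f t = 0.
Proof.
move=> bf tn; elim: bf => [c k l|g1 g2 _ h1 _ h2]; last by rewrite h1 h2 addr0.
rewrite /flat subr_gt0; move: tn; case: (0 < t) => /=; last by rewrite mul0r mulr0.
by move=> /negbTE ->; rewrite !mulr0.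
Qed.

(** Order 0 is exp(-1/t) exp(-1/(1-t)) on the unit interval; the factor [1] gives it the shape of
    [bump_prod]. *)
Definition bumpn (k : nat) : R -> R :=
  iter k (fun f : R -> R => 'D_(1 : R) f) (fun t => 1 * (flat 0 t * flat 0 (1 - t))).

Lemma bump_classP k : bump_class (bumpn k).
Proof.
elim: k => [|k /bump_class_derive[f' bf' df']]; first exact: bump_prod.
rewrite /bumpn iterS -/(bumpn k) (_ : 'D_(1 : R) (bumpn k) = f') //.
by apply/funext => t; exact: derive_val.
Qed.

Lemma derivable_bump k (t : R) : derivable (bumpn k) t 1.
Proof. by have [f' _ df'] := bump_class_derive (bump_classP k); exact: ex_derive. Qed.

Lemma continuous_bump k : continuous (bumpn k).
Proof.
by move=> x; apply/differentiable_continuous/derivable1_diffP; exact: derivable_bump.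
Qed.

Lemma bump_out k (t : R) : ~~ (0 < t < 1) -> bumpn k t = 0.
Proof. by apply: bump_class_out; exact: bump_classP. Qed.

Lemma bump_bounded1 k : exists2 M, 1 <= M & forall t, `|bumpn k t| <= M.
Proof.
have : compact (bumpn k @` `[0, 1]).
  apply: continuous_compact; last exact: segment_compact.
  by apply: continuous_subspaceT; exact: continuous_bump.
move=> /compact_bounded[M [Mr HM]].
exists (`|M| + 1) => [|t]; first by rewrite lerDr.
have [t01|/bump_out ->] := boolP (0 < t < 1); last by rewrite normr0 addr_ge0.
apply: HM; first by rewrite ltr_pwDr // ler_norm.
by exists t => //=; rewrite in_itv /=; case/andP: t01 => *; rewrite !ltW.
Qed.

Lemma bump_bounded r : exists2 M, 1 <= M & forall k t, (k <= r)%N -> `|bumpn k t| <= M.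
Proof.
elim: r => [|r [M M1 HM]].
  have [N N1 HN] := bump_bounded1 0; exists N => // k t.
  by rewrite leqn0 => /eqP ->.
have [N N1 HN] := bump_bounded1 r.+1.
exists (Num.max M N) => [|k t]; first by rewrite le_max M1.
rewrite leq_eqVlt => /predU1P[->|kr]; first by rewrite le_max HN orbT.
by rewrite le_max HM.
Qed.

Lemma bump_ge0 (t : R) : 0 <= bumpn 0 t.
Proof.
by rewrite /bumpn /= mul1r /flat; apply: mulr_ge0; case: ifP => // _;
  rewrite expr0 mul1r expR_ge0.
Qed.

Lemma bump_le1 (t : R) : bumpn 0 t <= 1.
Proof.
have flat1 s : 0 <= flat 0 s <= 1.
  rewrite /flat; case: ifPn => [s0|_]; last by rewrite lexx ler01.
  by rewrite expr0 mul1r expR_ge0 /= -[leRHS]expR0 ler_expR oppr_le0 invr_ge0 ltW.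
rewrite /bumpn /= mul1r; have /andP[a0 a1] := flat1 t; have /andP[b0 b1] := flat1 (1 - t).
by rewrite mulr_ile1.
Qed.

(** On the middle half, 1/t and 1/(1-t) are both at most 4, so each exponential factor is at least
    exp(-4). *)
Lemma bump_ge (t : R) : 4^-1 <= t <= 3 / 4 -> expR (- 8) <= bumpn 0 t.
Proof.
move=> /andP[t1 t2]; have q s : 4^-1 <= s -> expR (- 4) <= flat 0 s.
  move=> s4; have s0 : 0 < s by rewrite (lt_le_trans _ s4) // invr_gt0.
  by rewrite /flat s0 expr0 mul1r ler_expR lerN2 -[leRHS]invrK lef_pV2 ?posrE ?invr_gt0.
rewrite /bumpn /= mul1r (_ : - 8 = - 4 + - 4 :> R); last lra.
by rewrite expRD ler_pM ?expR_ge0 ?q //; lra.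
Qed.

End bump.


(** * Tensor-product bumps on the cube of corner [c] and side [a] *)

Section tensor_bump.
Context {R : realType} {n : nat}.
Local Notation mu := (@lebesgue_rV R n).
Local Notation dir i := (delta_mx ord0 i : 'rV[R]_n).
Variables (c : 'rV[R]_n) (a : R).
Hypothesis a_gt0 : 0 < a.
Implicit Types (ka : 'I_n -> nat).

Definition tensor_bump ka (y : 'rV[R]_n) : R :=
  \prod_(i < n) bumpn (ka i) ((y ord0 i - c ord0 i) / a).

Let is_derive_scaled k (i : 'I_n) (t : R) :
  is_derive t 1 (fun t : R => bumpn k ((t - c ord0 i) / a))
    (a^-1 * bumpn k.+1 ((t - c ord0 i) / a)).
Proof.
have d1 : is_derive t 1 (fun t : R => a^-1 *: (t - c ord0 i)) a^-1.
  by apply: is_derive_eq; rewrite subr0 [LHS]mulr1.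
have d2 : is_derive (a^-1 *: (t - c ord0 i)) 1 (bumpn k) (bumpn k.+1 (a^-1 *: (t - c ord0 i))).
  by apply: DeriveDef => //; exact: derivable_bump.
have := @is_derive1_comp R (bumpn k) (fun t => a^-1 *: (t - c ord0 i)) t _ _ d2 d1.
rewrite /GRing.scale /= => d.
rewrite (_ : (fun t => _) = bumpn k \o (fun t => a^-1 * (t - c ord0 i))); last first.
  by apply/funext => s /=; rewrite mulrC.
rewrite [X in is_derive _ _ _ X](_ : _ = bumpn k.+1 (a^-1 * (t - c ord0 i)) * a^-1) //.
by rewrite mulrC [(t - _) / a]mulrC.
Qed.

Let derive_tensor_bump ka i (x : 'rV[R]_n) :
  derivable (tensor_bump ka) x (dir i) /\
  'D_(dir i) (tensor_bump ka) x =
    a^-1 * tensor_bump (fun j => (j == i) + ka j)%N x.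
Proof.
have [d e] := @derive_prod_coord _ _
  (fun j t => bumpn (ka j) ((t - c ord0 j) / a)) x i
  (@ex_derive _ _ _ _ _ _ _ (is_derive_scaled (ka i) i (x ord0 i))).
split => //; rewrite e /tensor_bump !(bigD1 i (P := xpredT)) //= eqxx.
rewrite (@derive_val _ _ _ _ _ _ _ (is_derive_scaled (ka i) i (x ord0 i))) add1n mulrA.
by congr (_ * _); apply: eq_bigr => j /negbTE ->.
Qed.

Lemma continuous_tensor_bump ka : continuous (tensor_bump ka).
Proof.
apply: (continuous_prod_coord (h := fun i t => bumpn (ka i) ((t - c ord0 i) / a))) => i t.
by apply/differentiable_continuous/derivable1_diffP;
  exact: (ex_derive (is_derive := is_derive_scaled (ka i) i t)).
Qed.

(** By the chain rule each partial costs one factor 1/a. With a comparable to h_K and r - j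
    partials, this is the source of the weight h_K^(j-r). *)
Lemma iter_partial_tensor_bump s : iter_partial s (tensor_bump (fun=> 0%N)) =
  (fun y => a^-1 ^+ size s * tensor_bump (fun i => count_mem i s) y).
Proof.
elim: s => [|i s IH] /=; first by apply/funext => y; rewrite mul1r.
apply/funext => y; rewrite IH.
have [d e] := derive_tensor_bump (fun j => count_mem j s) i y.
rewrite (_ : (fun y => _) = a^-1 ^+ size s *: tensor_bump (fun j => count_mem j s)) //.
rewrite deriveZ // e exprSr -mulrA; congr (_ * (_ * _)).
by apply: eq_bigr => j _; rewrite eq_sym.
Qed.

Lemma tensor_bump_out ka y : ~ cube c a y -> tensor_bump ka y = 0.
Proof.
move=> yc; have [i yi] : exists i, ~~ (c ord0 i <= y ord0 i <= c ord0 i + a).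
  by apply: contra_notP yc => /forallNP h i; apply/negPn/negP; exact: h.
rewrite /tensor_bump (bigD1 i) //= bump_out ?mul0r //.
apply: contra yi => /andP[h1 h2]; move: h1 h2.
rewrite pmulr_lgt0 ?invr_gt0 // subr_gt0 ltr_pdivrMr // mul1r ltrBlDl => h1 h2.
by rewrite !ltW.
Qed.

Lemma test_tensor_bump D : cube c a `<=` D ->
  test_function D (tensor_bump (fun=> 0%N)).
Proof.
move=> cD; split; last first.
  exists (cube c a); split => //; first exact: compact_cube.
  by move=> y; exact: tensor_bump_out.
move=> s; rewrite iter_partial_tensor_bump; split.
  apply: continuous_mul; last exact: continuous_tensor_bump.
  by move=> x; exact: cst_continuous.
move=> i x; apply: (@derivableZ _ _ _ (tensor_bump _)).
exact: (derive_tensor_bump _ _ _).1.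
Qed.

Lemma tensor_bump_le ka r M : 1 <= M ->
  (forall k t, (k <= r)%N -> `|bumpn k t : R| <= M) ->
  (forall i, (ka i <= r)%N) -> forall y, `|tensor_bump ka y| <= M ^+ n.
Proof.
move=> M1 HM kar y; rewrite normr_prod -[n in M ^+ n]card_ord -prodr_const.
by apply: ler_prod => i _; rewrite normr_ge0 HM.
Qed.

Lemma iter_partial_bump_le s r M : 1 <= M ->
  (forall k t, (k <= r)%N -> `|bumpn k t : R| <= M) -> (size s <= r)%N ->
  forall y, `|iter_partial s (tensor_bump (fun=> 0%N)) y| <= a^-1 ^+ size s * M ^+ n.
Proof.
move=> M1 HM sr y; rewrite iter_partial_tensor_bump normrM ger0_norm.
  rewrite ler_wpM2l ?exprn_ge0 ?invr_ge0 ?(ltW a_gt0) //.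
  by apply: (tensor_bump_le M1 HM) => i; rewrite (leq_trans (count_size _ _)).
by rewrite exprn_ge0 ?invr_ge0 ?(ltW a_gt0).
Qed.

Lemma tensor_bump_ge0 y : 0 <= tensor_bump (fun=> 0%N) y.
Proof. by apply: prodr_ge0 => i _; exact: bump_ge0. Qed.

Lemma tensor_bump_le1 y : tensor_bump (fun=> 0%N) y <= 1.
Proof. by apply: prodr_ile1 => i _; rewrite bump_ge0 bump_le1. Qed.

(** On the concentric cube of half the side, every coordinate is in the middle half of its interval,
    so the bump is at least exp(-8)^n there. *)
Lemma integral_tensor_bump_ge (D : set 'rV[R]_n) : measurable D -> cube c a `<=` D ->
  (((expR (- 8) * (a / 2)) ^+ n)%:E <=
   \int[mu]_(x in D) (tensor_bump (fun=> 0%N) x)%:E)%E.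
Proof.
move=> mD cD; pose c' : 'rV[R]_n := \row_i (c ord0 i + a / 4).
have a2 : 0 <= a / 2 by rewrite divr_ge0 // ltW.
have c'c : cube c' (a / 2) `<=` cube c a.
  move=> y h i; have := h i; rewrite mxE => /andP[h1 h2].
  by have := a_gt0; apply/implyP; rewrite implybE; lra.
have mc' : measurable (cube c' (a / 2)).
  by apply: compact_measurable_rV; exact: compact_cube.
apply: (@le_trans _ _ (\int[mu]_(x in cube c' (a / 2)) (tensor_bump (fun=> 0%N) x)%:E)%E);
    last first.
  apply: ge0_subset_integral => //.
  - by apply/measurable_EFinP; apply: continuous_measurable_rV; exact: continuous_tensor_bump.
  - by move=> x _; rewrite lee_fin tensor_bump_ge0.
  - exact: subset_trans cD.
apply: (@le_trans _ _ (\int[mu]_(x in cube c' (a / 2)) (expR (- 8) ^+ n)%:E)%E).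
  by rewrite integral_cst // [X in (_ * X)%E]lebesgue_cube // -EFinM -exprMn.
apply: ge0_le_integral => //.
- by apply/measurable_EFinP; apply: continuous_measurable_rV; exact: continuous_tensor_bump.
- move=> x xc'; rewrite lee_fin -[n in expR _ ^+ n]card_ord -prodr_const.
  apply: ler_prod => i _; rewrite expR_ge0 bump_ge //.
  have := xc' i; rewrite mxE ler_pdivlMr // ler_pdivrMr // => /andP[h1 h2].
  by apply/andP; split; lra.
Qed.

End tensor_bump.

(** * Lipschitz functions are dense in L^1 *)

Section lipschitz_approximation.
Context {R : realType} {n : nat}.
Local Notation mu := (@lebesgue_rV R n).
Implicit Types (f g : 'rV[R]_n -> R).

(** Open sets are stable under intersection, so this description of the sigma-algebra permits a
    Dynkin induction that starts from open sets. *)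
Lemma measurable_rV_open :
  @measurable _ 'rV[R]_n = <<s [set U : set 'rV[R]_n | open U] >>.
Proof.
apply/seteqP; split => [A mA|]; last first.
  by apply: smallest_sub; [exact: sigma_algebra_measurable|exact: open_measurable_rV].
pose T := g_sigma_algebraType [set U : set 'rV[R]_n | open U].
have mid : measurable_fun [set: T] (fun x : T => x : 'rV[R]_n).
  apply: measurable_fun_rV => i; apply: (measurability _ (RGenOpens.measurableE R)).
  move=> _ [_ [a [b ->] <-]]; rewrite setTI; apply: sub_sigma_algebra => /=.
  have /continuousP := @coord_continuous R 1 n ord0 i; apply; exact: interval_open.
by have := mid measurableT A mA; rewrite setTI.
Qed.

Definition lipschitz_fun (L : R) f := forall x y, `|f x - f y| <= L * `|x - y|.

Lemma lipschitz_fun_continuous L f : lipschitz_fun L f -> continuous f.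
Proof.
move=> Lf x U /(nbhs_ballP (f x))[e /= e0 eU].
apply/nbhs_ballP; exists (e / (`|L| + 1)); first by rewrite /= divr_gt0 // ltr_wpDl.
move=> y; rewrite -ball_normE /= ltr_pdivlMr ?ltr_wpDl // => xy; apply: eU.
rewrite -ball_normE /=.
apply: le_lt_trans (Lf x y) (le_lt_trans _ xy).
by rewrite mulrC ler_wpM2l // (le_trans (ler_norm _)) // lerDl.
Qed.

Definition setdist (F : set 'rV[R]_n) (x : 'rV[R]_n) : R := inf [set `|x - y| | y in F].

Let setdist_has_lbound (F : set 'rV[R]_n) x : has_lbound [set `|x - y| | y in F].
Proof. by exists 0 => _ [y _ <-]. Qed.

Lemma setdist_lipschitz F : F !=set0 -> lipschitz_fun 1 (setdist F).
Proof.
move=> [z0 Fz0]; have H x y : setdist F x <= `|x - y| + setdist F y.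
  rewrite -lerBlDl; apply: lb_le_inf; first by exists `|y - z0|, z0.
  move=> _ [z Fz <-]; rewrite lerBlDl (le_trans _ (ler_distD y x z)) //.
  by apply: ge_inf; [exact: setdist_has_lbound|exists z].
move=> x y; have := H x y; have := H y x; rewrite mul1r (distrC y x) ler_norml.
by move=> h1 h2; apply/andP; split; lra.
Qed.

Lemma setdist_in F x : F x -> setdist F x = 0.
Proof.
move=> Fx; apply/le_anti/andP; split.
  by apply: ge_inf; [exact: setdist_has_lbound|exists x => //; rewrite subrr normr0].
by apply: lb_le_inf; [exists `|x - x|, x|move=> _ [y _ <-]].
Qed.

Lemma setdist_gt0 F x : closed F -> F !=set0 -> ~ F x -> 0 < setdist F x.
Proof.
move=> cF [z0 Fz0] Fx.
have /nbhs_ballP[e /= e0 eF] : nbhs x (~` F).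
  by apply: open_nbhs_nbhs; split => //; exact: closed_openC.
apply: (lt_le_trans e0); apply: lb_le_inf; first by exists `|x - z0|, z0.
move=> _ [y Fy <-]; rewrite leNgt; apply/negP => xy.
by apply: (eF y) => //; rewrite -ball_normE.
Qed.

Variable G : set 'rV[R]_n.
Hypotheses (mG : measurable G) (Goo : (mu G < +oo)%E).

Lemma integral_small (h : nat -> 'rV[R]_n -> R) :
  (forall k, measurable_fun G (h k)) -> (forall k x, 0 <= h k x <= 1) ->
  (forall x, h k x @[k --> \oo] --> (0 : R)) ->
  forall e : R, 0 < e -> exists k, (\int[mu]_(x in G) (h k x)%:E <= e%:E)%E.
Proof.
move=> mh h01 h0 e e0.
have : (\int[mu]_(x in G) (h k x)%:E @[k --> \oo] --> \int[mu]_(x in G) (cst 0 x))%E.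
  apply: (@dominated_cvg _ _ _ _ _ _ _ _ (cst 1%E)) => //.
  - by move=> k; apply/measurable_EFinP.
  - by move=> x _; apply: cvg_EFin; [exact: nearW|exact: h0].
  - by apply/integrableP; split => //; under eq_integral do rewrite /= normr1;
      rewrite integral_cst // mul1e.
  - by move=> k x _; have /andP[? ?] := h01 k x; rewrite /= ger0_norm // lee_fin.
rewrite integral0 => /fine_cvgP[fin /cvgrPdist_le /(_ _ e0) He].
have [k [/= kfin]] := filter_ex (filterI fin He).
rewrite sub0r normrN => ke; exists k; rewrite -(fineK kfin) lee_fin.
exact: le_trans (ler_norm _) ke.
Qed.

(** Density of Lipschitz functions in L^1(G), one function at a time. The approximants are also
    required to be bounded, so that they and their products with the bumps are integrable on [G]. *)
Definition lip_approx f := forall e : R, 0 < e -> exists g L,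
  [/\ lipschitz_fun L g, exists M, forall x, `|g x| <= M &
      (\int[mu]_(x in G) `|f x - g x|%:E <= e%:E)%E].

Lemma lip_approxD f1 f2 : measurable_fun G f1 -> measurable_fun G f2 ->
  lip_approx f1 -> lip_approx f2 -> lip_approx (fun x => f1 x + f2 x).
Proof.
move=> m1 m2 h1 h2 e e0; have e2 : 0 < e / 2 by rewrite divr_gt0.
have [g1 [L1 [lg1 [M1 b1] i1]]] := h1 _ e2.
have [g2 [L2 [lg2 [M2 b2] i2]]] := h2 _ e2.
have mg1 : measurable_fun G g1.
  by apply: continuous_measurable_rV; exact: lipschitz_fun_continuous lg1.
have mg2 : measurable_fun G g2.
  by apply: continuous_measurable_rV; exact: lipschitz_fun_continuous lg2.
exists (fun x => g1 x + g2 x), (L1 + L2); split.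
- by move=> x y; rewrite mulrDl opprD addrACA (le_trans (ler_normD _ _)) // lerD.
- by exists (M1 + M2) => x; rewrite (le_trans (ler_normD _ _)) // lerD.
- rewrite (splitr e) EFinD; apply: le_trans (leeD i1 i2).
  rewrite -ge0_integralD //; last 2 first.
  - by apply/measurable_EFinP/measurableT_comp => //; exact: measurable_funB.
  - by apply/measurable_EFinP/measurableT_comp => //; exact: measurable_funB.
  apply: ge0_le_integral => //.
  - apply/measurable_EFinP/measurableT_comp => //.
    by apply: measurable_funB; exact: measurable_funD.
  - by apply: emeasurable_funD; apply/measurable_EFinP/measurableT_comp => //;
      exact: measurable_funB.
  - by move=> x _; rewrite -EFinD lee_fin opprD addrACA ler_normD.
Qed.

Lemma lip_approxZ f (c : R) : measurable_fun G f ->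
  lip_approx f -> lip_approx (fun x => c * f x).
Proof.
move=> mf h e e0; have c0 : 0 < `|c| + 1 by rewrite ltr_wpDl.
have [g [L [lg [M b] i]]] := h (e / (`|c| + 1)) ltac:(by rewrite divr_gt0).
have mg : measurable_fun G g.
  by apply: continuous_measurable_rV; exact: lipschitz_fun_continuous lg.
exists (fun x => c * g x), (`|c| * L); split.
- by move=> x y; rewrite -mulrBr normrM -mulrA ler_wpM2l.
- by exists (`|c| * M) => x; rewrite normrM ler_wpM2l.
- apply: (@le_trans _ _ ((`|c| + 1)%:E * \int[mu]_(x in G) `|f x - g x|%:E)%E).
    rewrite -ge0_integralZl //; last first.
      by apply/measurable_EFinP/measurableT_comp => //; exact: measurable_funB.
    apply: ge0_le_integral => //.
    - apply/measurable_EFinP/measurableT_comp => //.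
      by apply: measurable_funB; exact: measurable_funM.
    - apply: measurable_funeM; apply/measurable_EFinP/measurableT_comp => //.
      exact: measurable_funB.
    - by move=> x _; rewrite -EFinM lee_fin -mulrBr normrM ler_wpM2r // lerDl.
  rewrite -[leRHS](_ : ((`|c| + 1) * (e / (`|c| + 1)))%:E = _).
    by rewrite EFinM lee_wpmul2l // lee_fin ltW.
  by rewrite mulrC divfK // gt_eqF.
Qed.

Lemma lip_approx_lim f : measurable_fun G f ->
  (forall e : R, 0 < e -> exists g, [/\ measurable_fun G g, lip_approx g &
    (\int[mu]_(x in G) `|f x - g x|%:E <= e%:E)%E]) -> lip_approx f.
Proof.
move=> mf h e e0; have e2 : 0 < e / 2 by rewrite divr_gt0.
have [g [mg ag ig]] := h _ e2; have [k [L [lk Mk ik]]] := ag _ e2.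
have mk : measurable_fun G k.
  by apply: continuous_measurable_rV; exact: lipschitz_fun_continuous lk.
exists k, L; split => //; rewrite (splitr e) EFinD; apply: le_trans (leeD ig ik).
rewrite -ge0_integralD //; last 2 first.
- by apply/measurable_EFinP/measurableT_comp => //; exact: measurable_funB.
- by apply/measurable_EFinP/measurableT_comp => //; exact: measurable_funB.
apply: ge0_le_integral => //.
- by apply/measurable_EFinP/measurableT_comp => //; exact: measurable_funB.
- by apply: emeasurable_funD; apply/measurable_EFinP/measurableT_comp => //;
    exact: measurable_funB.
- by move=> x _; rewrite -EFinD lee_fin ler_distD.
Qed.

Lemma lip_approx_const (c : R) : lip_approx (fun=> c).
Proof.
move=> e e0; exists (fun=> c), 0; split.
- by move=> x y; rewrite subrr normr0 mul0r.
- by exists `|c|.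
- under eq_integral do rewrite subrr normr0.
  by rewrite integral0 lee_fin ltW.
Qed.

(** The functions min(1, k dist(x, complement of U)) are k-Lipschitz with values in the unit
    interval and converge pointwise to the indicator; dominated convergence applies since [G] has
    finite measure. *)
Lemma lip_approx_open U : open U -> lip_approx \1_U.
Proof.
(* The infimum of the empty set is 0, so the distance to an empty complement would be 0 and the
   approximants would vanish. *)
move=> oU; have [->|UT] := eqVneq U setT.
  by rewrite indicT; exact: lip_approx_const.
have U0 : ~` U !=set0 by apply/set0P; apply: contra UT => /eqP; rewrite -setCT => /setC_inj ->.
have d0 x : 0 <= setdist (~` U) x.
  by apply: lb_le_inf => [|_ [y _ <-]//]; case: U0 => z Uz; exists `|x - z|, z.
pose g k x : R := Num.min 1 (k%:R * setdist (~` U) x).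
have lg k : lipschitz_fun k%:R (g k).
  move=> x y; apply: (@le_trans _ _ `|k%:R * setdist (~` U) x - k%:R * setdist (~` U) y|).
    rewrite /g /Num.min; case: ifPn => h1; case: ifPn => h2 //.
    - by rewrite subrr normr0.
    - by rewrite -leNgt in h2; rewrite !ger0_norm; lra.
    - by rewrite -leNgt in h1; rewrite distrC [leRHS]distrC !ger0_norm; lra.
  rewrite -mulrBr normrM normr_nat ler_wpM2l //.
  by have := setdist_lipschitz U0 x y; rewrite mul1r.
have g01 k x : 0 <= g k x <= 1.
  by rewrite /g ge_min lexx le_min ler01 mulr_ge0.
apply: lip_approx_lim; first exact: measurable_indic (open_measurable_rV oU).
move=> e e0.
have [k ik] : exists k, (\int[mu]_(x in G) (`|\1_U x - g k x|)%:E <= e%:E)%E.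
  apply: integral_small e0.
  - move=> k; apply: measurableT_comp => //; apply: measurable_funB.
      exact: measurable_indic (open_measurable_rV oU).
    by apply: continuous_measurable_rV; exact: lipschitz_fun_continuous (lg k).
  - move=> k x; rewrite normr_ge0 /=; have /andP[? ?] := g01 k x.
    by rewrite indicE; case: (x \in U) => /=; rewrite ler_norml; apply/andP; split; lra.
  - move=> x; have [Ux|Ux] := pselect (U x); last first.
      rewrite (_ : (fun k => _) = fun=> 0); first exact: cvg_cst.
      apply/funext => k; rewrite /g (setdist_in (F := ~` U)) // mulr0.
      by rewrite indicE memNset // min_r // subrr normr0.
    have dx : 0 < setdist (~` U) x.
      by apply: setdist_gt0 => //; exact: open_closedC.
    apply: cvg_near_cst; exists (Num.truncn (setdist (~` U) x)^-1).+1 => // k /= kd.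
    rewrite /g indicE mem_set // min_l ?subrr ?normr0 //.
    by rewrite -ler_pdivrMr // mul1r (le_trans (ltW (truncnS_gt _))) // ler_nat.
exists (g k); split => //.
  by apply: continuous_measurable_rV; exact: lipschitz_fun_continuous (lg k).
move=> e' e'0; exists (g k), k%:R; split => //.
  by exists 1 => x; have /andP[? ?] := g01 k x; rewrite ger0_norm.
under eq_integral do rewrite subrr normr0.
by rewrite integral0 lee_fin ltW.
Qed.

Lemma lip_approx_sum (I : Type) (s : seq I) (f : I -> 'rV[R]_n -> R) :
  (forall i, measurable_fun G (f i)) -> (forall i, lip_approx (f i)) ->
  lip_approx (fun x => \sum_(i <- s) f i x).
Proof.
move=> mf af; elim: s => [|i s IH].
  by under eq_fun do rewrite big_nil; exact: lip_approx_const.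
under eq_fun do rewrite big_cons; apply: lip_approxD => //.
exact: measurable_sum.
Qed.

(** The sets whose indicator can be approximated form a Dynkin class: complements follow from
    linearity, countable disjoint unions from dominated convergence. *)
Lemma lip_approx_indic A : measurable A -> lip_approx \1_A.
Proof.
rewrite measurable_rV_open; 
apply: (dynkin_induction (P := fun A => lip_approx (\1_A : 'rV[R]_n -> R)) measurable_rV_open).
- by move=> U V; exact: openI.
- by rewrite indicT; exact: lip_approx_const.
- exact: lip_approx_open.
- move=> S mS aS; rewrite (_ : \1_(~` S) = fun x => 1 + -1 * \1_S x); last first.
    by apply/funext => x; rewrite !indicE in_setC; case: (x \in S) => /=; lra.
  apply: lip_approxD => //; last 2 first.
  - exact: lip_approx_const.
  - by apply: lip_approxZ => //; exact: measurable_indic.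
  by apply: measurable_funM => //; exact: measurable_indic.
- move=> F mF tF aF; have mI B : measurable B -> measurable_fun G (\1_B : 'rV[R]_n -> R).
    by move=> mB; exact: measurable_indic.
  have mU : measurable (\bigcup_k F k) by exact: bigcup_measurable.
  apply: lip_approx_lim; first exact: mI.
  (* By disjointness the partial sums are themselves indicators, hence take values in the unit
     interval and differ from the limit by at most 1. *)
  move=> e e0; pose g N x : R := \sum_(k < N) \1_(F k) x.
  have gE N x : g N x = \1_(\big[setU/set0]_(k < N) F k) x.
    rewrite /g; elim: N => [|N IH]; first by rewrite !big_ord0 indic0.
    rewrite !big_ord_recr /= IH !indicE in_setU.
    have [xN|xN] := boolP (x \in F N); last by rewrite orbF addr0.
    rewrite orbT memNset ?add0r // -bigcup_mkord => -[k /= kN Fkx].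
    suff kNE : k = N by rewrite kNE ltnn in kN.
    apply: tF => //.
    by exists x; split => //; exact: set_mem.
  have mg N : measurable_fun G (g N) by apply: measurable_sum => k; exact: mI.
  have [N iN] : exists N, (\int[mu]_(x in G) (`|\1_(\bigcup_k F k) x - g N x|)%:E <= e%:E)%E.
    apply: integral_small e0.
    - by move=> N; apply: measurableT_comp => //; apply: measurable_funB => //; exact: mI.
    - move=> N x; rewrite normr_ge0 /= gE !indicE.
      by case: (_ \in _); case: (_ \in _); rewrite ?subrr ?normr0 ?subr0 ?normr1 ?sub0r ?normrN1.
    - move=> x; have [[k _ Fkx]|Fx] := pselect ((\bigcup_k F k) x); last first.
        rewrite (_ : (fun k => _) = fun=> 0); first exact: cvg_cst.
        apply/funext => N; rewrite gE !indicE !memNset ?subrr ?normr0 //.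
        by rewrite -bigcup_mkord => -[k _ Fkx]; apply: Fx; exists k.
      apply: cvg_near_cst; exists k.+1 => // N /= kN.
      rewrite gE !indicE !mem_set ?subrr ?normr0 //; last by exists k.
      by rewrite -bigcup_mkord; exists k.
  exists (g N); split => //; rewrite /g.
  under eq_fun do rewrite -(big_mkord xpredT (fun k => \1_(F k) _)).
  by apply: lip_approx_sum => k //; exact: mI.
Qed.

Import HBSimple.

Lemma lip_approx_integrable f : mu.-integrable G (EFin \o f) -> lip_approx f.
Proof.
move=> intf; have mf : measurable_fun G f by case/integrableP: (intf) => /measurable_EFinP.
apply: lip_approx_lim => // e e0.
have [g [ig _ gf]] := approximation_sfun_integrable mG intf.
move: gf => /fine_cvgP[fin /cvgrPdist_le /(_ _ e0) He].
have [k [/= kfin]] := filter_ex (filterI fin He).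
rewrite sub0r normrN => ke; exists (g k); split.
- exact: measurable_funTS.
- have -> : (g k : 'rV[R]_n -> R) =
      (fun x => \sum_(y <- finmap.enum_fset (fset_set (range (g k)))) y * \1_(g k @^-1` [set y]) x).
    by apply/funext => x; rewrite fimfunE fsbig_finite.
  apply: lip_approx_sum => y.
    by apply: measurable_funM => //; exact: measurable_indic.
  apply: lip_approxZ; first exact: measurable_indic.
  exact: lip_approx_indic.
- rewrite -(fineK kfin) lee_fin; exact: le_trans (ler_norm _) ke.
Qed.

End lipschitz_approximation.

(** * Local averages *)

Section averages.
Context {R : realType} {n : nat}.
Local Notation mu := (@lebesgue_rV R n).
Variables (G : set 'rV[R]_n) (w : 'rV[R]_n -> R).
Hypotheses (oG : open G) (Goo : (mu G < +oo)%E).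
Hypothesis iw : mu.-integrable G (EFin \o w).
Hypothesis w_gt0 : (0 < \int[mu]_(x in G) `|w x|%:E)%E.

Let mG : measurable G. Proof. exact: open_measurable_rV. Qed.

(** An element of diameter less than [e] that meets this set is contained in [G]. *)
Definition inner_set (e : R) : set 'rV[R]_n := [set x | ball x e `<=` G].

Lemma measurable_inner_set e : measurable (inner_set e).
Proof.
rewrite -[inner_set e]setCK; apply: measurableC; apply: open_measurable_rV.
have -> : ~` inner_set e = \bigcup_(y in ~` G) ball y e.
  apply/seteqP; split => x.
    by move=> /existsNP[y /not_implyP[xy Gy]]; exists y => //; exact: ball_sym.
  by move=> [y Gy yx] xG; apply: Gy; apply: xG; exact: ball_sym.
by apply: bigcup_open => y _; exact: ball_open.
Qed.

(** As [G] is open, the inner sets of radius 1/(k+1) increase to [G], and the integrals converge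
    monotonically. *)
Lemma integral_inner_set (c : R) : (c%:E < \int[mu]_(x in G) `|w x|%:E)%E ->
  exists2 e : R, 0 < e & (c%:E <= \int[mu]_(x in inner_set e) `|w x|%:E)%E.
Proof.
move=> cw; pose F k := inner_set k.+1%:R^-1.
have F0 k : 0 < k.+1%:R^-1 :> R by rewrite invr_gt0.
have FG : \bigcup_k F k = G.
  apply/seteqP; split => [x [k _ xG]|x Gx]; first by apply: xG; exact: ballxx.
  have /nbhs_ballP[e /= e0 eG] : nbhs x G by exact: open_nbhs_nbhs.
  exists (Num.truncn e^-1) => //; apply: subset_trans eG; apply: le_ball.
  by rewrite -[leRHS]invrK lef_pV2 ?posrE ?invr_gt0 // ltW // truncnS_gt.
have mF k : measurable (F k) by exact: measurable_inner_set.
have FkG k : F k `<=` G by move=> x; apply; exact: ballxx.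
have mw : measurable_fun G (fun x => `|w x|%:E).
  apply/measurable_EFinP/measurableT_comp => //.
  by case/integrableP: iw => /measurable_EFinP.
have cv : (\int[mu]_(x in F k) `|w x|%:E @[k --> \oo] --> \int[mu]_(x in G) `|w x|%:E)%E.
  rewrite -FG; apply: (@ge0_nondecreasing_set_cvg_integral _ _ _ F) => //.
  - move=> k k' kk'; apply/subsetPset => x xG; apply: subset_trans xG; apply: le_ball.
    by rewrite lef_pV2 ?posrE // ler_nat ltnS.
  - by move=> k; exact: measurable_funS (FkG k) mw.
have [k _ kc] := cv _ (open_ereal_gt' cw).
by exists k.+1%:R^-1 => //; apply/ltW/(kc k) => /=.
Qed.

Let integrable_le (f1 f2 : 'rV[R]_n -> R) : measurable_fun G f1 ->
  mu.-integrable G (EFin \o f2) -> (forall x, G x -> `|f1 x| <= f2 x) ->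
  mu.-integrable G (EFin \o f1).
Proof.
move=> m1 i2 le12; apply: (le_integrable mG _ _ i2); first exact/measurable_EFinP.
by move=> x Gx /=; rewrite lee_fin (le_trans (le12 x Gx)) // ler_norm.
Qed.

Let Rintegral_le (f1 f2 b : 'rV[R]_n -> R) :
  mu.-integrable G (EFin \o f1) -> mu.-integrable G (EFin \o f2) ->
  mu.-integrable G (EFin \o b) -> (forall x, G x -> `|f1 x - f2 x| <= b x) ->
  `|\int[mu]_(x in G) f1 x| <= `|\int[mu]_(x in G) f2 x| + \int[mu]_(x in G) b x.
Proof.
move=> i1 i2 ib le12.
have -> : \int[mu]_(x in G) f1 x =
    \int[mu]_(x in G) f2 x + \int[mu]_(x in G) (f1 x - f2 x).
  by rewrite RintegralB // addrC subrK.
have id : mu.-integrable G (EFin \o (fun x => f1 x - f2 x)).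
  by have := integrableB mG i1 i2.
rewrite (le_trans (ler_normD _ _)) // lerD2l (le_trans (le_normr_Rintegral _ _)) //.
apply: le_Rintegral => //; exact: (integrable_norm id).
Qed.

Section partition_of_unity_bound.
Variables (J : eqType) (E : seq J) (phi : J -> 'rV[R]_n -> R) (K : J -> set 'rV[R]_n).
Hypothesis uE : uniq E.
Hypothesis mphi : forall j, measurable_fun G (phi j).
Hypothesis phi01 : forall j x, 0 <= phi j x <= 1.
Hypothesis phi0 : forall j x, j \in E -> ~ (K j)° x -> phi j x = 0.
Hypothesis dK : forall i j, i \in E -> j \in E -> i <> j -> (K i)° `&` (K j)° = set0.

(** Interiors are disjoint, so at most one term is nonzero at a given point. *)
Lemma sum_disjoint_le1 x : \sum_(j <- E) phi j x <= 1.
Proof.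
have [/hasP[j jE jx]|/hasPn h] := boolP (has (fun j => phi j x != 0) E).
  rewrite (bigD1_seq j) //= big_seq_cond big1 ?addr0; first by case/andP: (phi01 j x).
  move=> i /andP[iE ij]; apply: phi0 => // Kix.
  have Kjx : (K j)° x by apply: contrapT => /(phi0 jE) e; rewrite e eqxx in jx.
  have : set0 x by rewrite -(@dK i j) //; exact/eqP.
  by [].
by rewrite big_seq big1 // => j /h; rewrite negbK => /eqP.
Qed.

Lemma sum_integral_le (psi : 'rV[R]_n -> R) : (forall x, 0 <= psi x) ->
  mu.-integrable G (EFin \o psi) ->
  \sum_(j <- E) \int[mu]_(x in G) (psi x * phi j x) <= \int[mu]_(x in G) psi x.
Proof.
move=> psi_ge0 ipsi.
have mpsi : measurable_fun G psi by case/integrableP: ipsi => /measurable_EFinP.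
have ij j : mu.-integrable G (EFin \o (fun x => psi x * phi j x)).
  apply: (integrable_le _ ipsi); first exact: measurable_funM.
  move=> x _; have /andP[a0 a1] := phi01 j x.
  by rewrite ger0_norm ?mulr_ge0 // ler_piMr.
have fj j : (\int[mu]_(x in G) (psi x * phi j x)%:E)%E \is a fin_num.
  exact: (integrable_fin_num mG (ij j)).
have fpsi : (\int[mu]_(x in G) (psi x)%:E)%E \is a fin_num by exact: (integrable_fin_num mG ipsi).
rewrite -lee_fin -sumEFin [leRHS]fineK //.
under eq_bigr do rewrite fineK //.
rewrite -ge0_integral_sum //; last 2 first.
- by move=> j; apply/measurable_EFinP; exact: measurable_funM.
- by move=> j x _; rewrite lee_fin mulr_ge0 //; case/andP: (phi01 j x).
apply: ge0_le_integral => //.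
- by move=> x _; apply: sume_ge0 => j _; rewrite lee_fin mulr_ge0 //; case/andP: (phi01 j x).
- by apply: emeasurable_sum => j; apply/measurable_EFinP; exact: measurable_funM.
- by apply/measurable_EFinP.
- move=> x _; rewrite sumEFin lee_fin -mulr_sumr ler_piMr //.
  exact: sum_disjoint_le1.
Qed.

End partition_of_unity_bound.

(** Let g be a Lipschitz approximation of w. On each K, g is nearly the constant g(x_K), so |g(x_K)|
    int phi_K is controlled by |int w phi_K| up to small errors. Conversely the elements cover an
    inner set carrying half of the mass of |w|, so that sum_K |g(x_K)| mu(K) is large, and the
    hypothesis mu(K) <= c0 int phi_K links the two. *)
Lemma averages_lower_bound (c0 : R) : 1 <= c0 -> exists c1 h0 : R,
  [/\ 0 < c1, 0 < h0 &
   forall (J : eqType) (E : seq J) (K : J -> set 'rV[R]_n)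
      (phi : J -> 'rV[R]_n -> R) (h : R),
     0 <= h -> h < h0 -> uniq E ->
     (forall j, continuous (phi j)) ->
     (forall j x, 0 <= phi j x <= 1) ->
     (forall j x, j \in E -> ~ (K j)° x -> phi j x = 0) ->
     (forall i j, i \in E -> j \in E -> i <> j -> (K i)° `&` (K j)° = set0) ->
     (forall j, j \in E -> [/\ measurable (K j), K j !=set0 &
        forall x y, K j x -> K j y -> `|x - y| <= h]) ->
     (forall j, j \in E ->
        (mu (K j) <= (c0 * \int[mu]_(x in G) phi j x)%:E)%E) ->
     (forall x e, h < e -> ball x e `<=` G -> exists2 j, j \in E & K j x) ->
     c1 <= \sum_(j <- E) `|\int[mu]_(x in G) (w x * phi j x)| /\
     \sum_(j <- E) \int[mu]_(x in G) phi j x <= fine (mu G)].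
Proof.
move=> c01; have c0_gt0 : 0 < c0 by rewrite (lt_le_trans ltr01).
have mw : measurable_fun G w by case/integrableP: iw => /measurable_EFinP.
have mwabs : measurable_fun G (fun x => `|w x|%:E).
  by apply/measurable_EFinP/measurableT_comp.
pose N := fine (\int[mu]_(x in G) `|w x|%:E)%E.
have NE : (\int[mu]_(x in G) `|w x|%:E)%E = N%:E.
  by rewrite fineK //; exact: (integrable_fin_num mG (integrable_norm iw)).
have N0 : 0 < N by rewrite -lte_fin -NE.
have [eta eta0 Heta] := @integral_inner_set (N / 2)
  ltac:(by rewrite NE lte_fin ltr_pdivrMr // ltr_pMr // ltr1n).
(* The approximation error enters once alone and once multiplied by [c0]; with this size each
   contribution is at most N/8. *)
have eps0 : 0 < N / (8 * c0) by rewrite divr_gt0 // mulr_gt0.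
have [g [L' [lg' [M gM] ig]]] := lip_approx_integrable mG Goo iw eps0.
pose L := `|L'|.
have lg x y : `|g x - g y| <= L * `|x - y|.
  by rewrite (le_trans (lg' x y)) // ler_wpM2r // ler_norm.
have L0 : 0 <= L by exact: normr_ge0.
have cg := lipschitz_fun_continuous lg'.
have mg : measurable_fun G g by exact: continuous_measurable_rV.
pose V := fine (mu G); have VE : mu G = V%:E by rewrite fineK // ge0_fin_numE.
have V0 : 0 <= V by rewrite -lee_fin -VE.
(* Below [eta] the elements cover the inner set; the second bound gives c0 L h V <= N/16. The [+ 1]
   keeps the denominator positive when L V is zero. *)
pose h0 := Num.min eta (N / (16 * c0 * (L * V + 1))).
have LV : 0 < L * V + 1 by rewrite ltr_wpDl // mulr_ge0.
exists (N / (8 * c0)), h0; split => //.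
  by rewrite /h0 lt_min eta0 divr_gt0 // !mulr_gt0.
move=> J E K phi h hge0 hh0 uE cphi phi01 phi0 dK EK muK cov.
have [heta hN] : h < eta /\ h < N / (16 * c0 * (L * V + 1)).
  by move: hh0; rewrite /h0 lt_min => /andP.
have mphi j : measurable_fun G (phi j) by exact: continuous_measurable_rV.
have bi (f : 'rV[R]_n -> R) B : measurable_fun G f -> (forall x, `|f x| <= B) ->
    mu.-integrable G (EFin \o f).
  move=> mf fB; apply: measurable_bounded_integrable => //.
  by exists B; split; [exact: num_real|move=> x Bx y _; exact: le_trans (fB y) (ltW Bx)].
have phi_le1 j x : `|phi j x| <= 1 by have /andP[? ?] := phi01 j x; rewrite ger0_norm.
have iphi j : mu.-integrable G (EFin \o phi j) by exact: bi (phi_le1 j).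
have sumphi : \sum_(j <- E) \int[mu]_(x in G) phi j x <= V.
  have i1 : mu.-integrable G (EFin \o (fun=> 1)).
    by apply: (bi _ 1) => // x; rewrite normr1.
  have V1 : \int[mu]_(x in G) 1 = V.
    by rewrite /Rintegral integral_cst // mul1e.
  rewrite -V1; apply: le_trans (sum_integral_le uE mphi phi01 phi0 dK (fun=> ler01) i1).
  by apply: ler_sum => j _; under [leRHS]eq_Rintegral do rewrite mul1r.
split => //.
have iwg : mu.-integrable G (EFin \o (fun x => `|w x - g x|)).
  have ig1 : mu.-integrable G (EFin \o g) by exact: bi gM.
  have := integrable_norm (integrableB mG iw ig1); exact.
have igphi j : mu.-integrable G (EFin \o (fun x => g x * phi j x)).
  apply: (bi _ M); first exact: measurable_funM.
  move=> x; rewrite normrM (le_trans _ (gM x)) // ler_piMr //.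
have iwphi j : mu.-integrable G (EFin \o (fun x => w x * phi j x)).
  apply: (integrable_le _ (integrable_norm iw)); first exact: measurable_funM.
  by move=> x _; rewrite normrM ler_piMr.
have iwgphi j : mu.-integrable G (EFin \o (fun x => `|w x - g x| * phi j x)).
  apply: (integrable_le _ iwg).
    apply: measurable_funM => //; apply: measurableT_comp => //; exact: measurable_funB.
  by move=> x _; rewrite normrM normr_id ler_piMr.
have sumD : \sum_(j <- E) \int[mu]_(x in G) (`|w x - g x| * phi j x) <= N / (8 * c0).
  apply: le_trans (@sum_integral_le J E phi K uE mphi phi01 phi0 dK _ _ iwg) _ => //.
  by rewrite -lee_fin fineK //; exact: (integrable_fin_num mG iwg).
have pickx : exists x : J -> 'rV[R]_n, forall j, j \in E -> K j (x j).
  have /choice[x xP] : forall j, exists x, j \in E -> K j x.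
    move=> j; have [jE|jE] := boolP (j \in E); last by exists 0.
    by have [_ [x Kx] _] := EK j jE; exists x.
  by exists x.
have [x xK] := pickx.
(* [g] is frozen at the point [x j] of the element, at the price of its oscillation [L * h], and is
   then replaced by [w]. *)
have term j : j \in E ->
    `|g (x j)| * \int[mu]_(y in G) phi j y <=
    `|\int[mu]_(y in G) (w y * phi j y)| +
    \int[mu]_(y in G) (`|w y - g y| * phi j y) +
    (L * h) * \int[mu]_(y in G) phi j y.
  move=> jE; have [_ _ Kh] := EK j jE.
  have P0 : 0 <= \int[mu]_(y in G) phi j y.
    by apply: Rintegral_ge0 => y _; case/andP: (phi01 j y).
  have E1 : `|g (x j)| * \int[mu]_(y in G) phi j y =
      `|\int[mu]_(y in G) (g (x j) * phi j y)|.
    by rewrite RintegralZl // normrM (ger0_norm P0).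
  have E2 : (L * h) * \int[mu]_(y in G) phi j y = \int[mu]_(y in G) (L * h * phi j y).
    by rewrite RintegralZl.
  rewrite E1 E2.
  have S1 : `|\int[mu]_(y in G) (g (x j) * phi j y)| <=
      `|\int[mu]_(y in G) (g y * phi j y)| + \int[mu]_(y in G) (L * h * phi j y).
    apply: Rintegral_le => //.
    - apply: (bi _ `|g (x j)|); first exact: measurable_funM.
      by move=> y; rewrite normrM ler_piMr.
    - apply: (bi _ (L * h)); first exact: measurable_funM.
      by move=> y; rewrite normrM [`|L * h|]ger0_norm ?mulr_ge0 // ler_piMr // mulr_ge0.
    - move=> y Gy; have [Ky|Ky] := pselect ((K j)° y); last first.
        by rewrite (phi0 _ _ jE Ky) !mulr0 subrr normr0.
      have /andP[p0 p1] := phi01 j y.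
      rewrite -mulrBl normrM (ger0_norm p0) ler_wpM2r // (le_trans (lg _ _)) //.
      by rewrite ler_wpM2l // Kh //; [exact: xK|exact: interior_subset].
  have S2 : `|\int[mu]_(y in G) (g y * phi j y)| <=
      `|\int[mu]_(y in G) (w y * phi j y)| + \int[mu]_(y in G) (`|w y - g y| * phi j y).
    apply: Rintegral_le => // y _; have /andP[p0 p1] := phi01 j y.
    by rewrite -mulrBl normrM (ger0_norm p0) distrC.
  by rewrite (le_trans S1) // lerD2r.
have sumterm : \sum_(j <- E) `|g (x j)| * \int[mu]_(y in G) phi j y <=
    \sum_(j <- E) `|\int[mu]_(y in G) (w y * phi j y)| + N / (8 * c0) + L * h * V.
  apply: (@le_trans _ _ (\sum_(j <- E) (`|\int[mu]_(y in G) (w y * phi j y)| +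
    \int[mu]_(y in G) (`|w y - g y| * phi j y) +
    (L * h) * \int[mu]_(y in G) phi j y))).
    by rewrite big_seq [leRHS]big_seq; apply: ler_sum.
  by rewrite !big_split /= -mulr_sumr !lerD // ler_wpM2l // mulr_ge0.
(* At a point y of the inner set lying in K, |w(y)| <= |w(y) - g(y)| + |g(x_K)| + L h; this is
   integrated and summed over the elements. *)
have cover : N / 2 - N / (8 * c0) <=
    c0 * (\sum_(j <- E) (`|g (x j)| + L * h) * \int[mu]_(y in G) phi j y).
  (* Measurability of a sum of functions is required for every index, also for those outside [E]. *)
  pose K' j := if j \in E then K j else set0.
  have mK' j : measurable (K' j).
    by rewrite /K'; case: ifPn => // jE; have [] := EK j jE.
  pose b j := `|g (x j)| + L * h.
  have b0 j : 0 <= b j by rewrite addr_ge0 // mulr_ge0.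
  have mb j : measurable_fun G (fun y => (b j * \1_(K' j) y)%:E).
    by apply/measurable_EFinP/measurable_funM => //; exact: measurable_indic.
  have mwg : measurable_fun G (fun y => `|w y - g y|%:E).
    by apply/measurable_EFinP/measurableT_comp => //; exact: measurable_funB.
  have msum : measurable_fun G (fun y => (\sum_(j <- E) (b j * \1_(K' j) y)%:E)%E).
    exact: emeasurable_sum.
  have sum0 y : (0 <= \sum_(j <- E) (b j * \1_(K' j) y)%:E)%E.
    by apply: sume_ge0 => j _; rewrite lee_fin mulr_ge0.
  have inG : inner_set eta `<=` G by move=> y; apply; exact: ballxx.
  have S : ((N / 2)%:E <= \sum_(j <- E) (b j)%:E * mu (K' j) + (N / (8 * c0))%:E)%E.
    apply: (le_trans Heta).
    apply: (@le_trans _ _ (\int[mu]_(y in G)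
        (\sum_(j <- E) (b j * \1_(K' j) y)%:E + `|w y - g y|%:E))%E).
      apply: (@le_trans _ _ (\int[mu]_(y in inner_set eta)
          (\sum_(j <- E) (b j * \1_(K' j) y)%:E + `|w y - g y|%:E))%E).
        have mi := measurable_inner_set eta.
        apply: ge0_le_integral => //.
        - exact: measurable_funS inG mwabs.
        - apply: emeasurable_funD; first exact: measurable_funS inG msum.
          exact: measurable_funS inG mwg.
        - move=> y yin; have [j jE Kjy] := cov y eta heta yin.
          rewrite sumEFin lee_fin addrC -lerBlDl.
          apply: (@le_trans _ _ (b j)).
            have [_ _ Kh] := EK j jE.
            have a1 : `|g y - g (x j)| <= L * h.
              by rewrite (le_trans (lg _ _)) // ler_wpM2l // Kh //; exact: xK.
            have a2 := ler_normD (w y - g y) (g y); rewrite subrK in a2.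
            have a3 := ler_normD (g y - g (x j)) (g (x j)); rewrite subrK in a3.
            by rewrite /b; lra.
          rewrite (bigD1_seq j) //= /K' jE indicE mem_set // mulr1 lerDl.
          by apply: sumr_ge0 => i _; rewrite mulr_ge0.
      apply: ge0_subset_integral => //; first exact: measurable_inner_set.
      - exact: emeasurable_funD.
      - by move=> y _; rewrite adde_ge0 // lee_fin.
    rewrite ge0_integralD //.
    rewrite leeD // ge0_integral_sum //; last first.
      by move=> j y _; rewrite lee_fin mulr_ge0.
    apply: lee_sum => j _; under eq_integral do rewrite EFinM.
    rewrite ge0_integralZl ?lee_fin //; last first.
      by apply/measurable_EFinP; exact: measurable_indic.
    rewrite integral_indic // lee_wpmul2l ?lee_fin // le_measure ?inE //.
    exact: measurableI.
  rewrite lerBlDr -lee_fin EFinD; apply: (le_trans S); rewrite leeD2r //.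
  rewrite mulr_sumr -sumEFin big_seq [leRHS]big_seq; apply: lee_sum => j jE.
  rewrite /K' jE mulrCA EFinM lee_wpmul2l ?lee_fin //; exact: muK.
move: cover; under eq_bigr do rewrite mulrDl; rewrite big_split /= -mulr_sumr.
set A := \sum_(j <- E) `|\int[mu]_(x in G) _| in sumterm *.
set B := \sum_(j <- E) _ * _ in sumterm *.
set P := \sum_(j <- E) _ in sumphi *.
move=> cover.
(* The budget: of N/2, the amounts N/8 for w - g on the inner set, N/8 for w - g against the bumps,
   and twice N/16 for the oscillation are lost, leaving c0 A >= N/8. *)
have P1 : L * h * P <= L * h * V by rewrite ler_wpM2l // mulr_ge0.
have e1 : c0 * (N / (8 * c0)) = N / 8.
  by field; rewrite gt_eqF.
have e2 : N / (8 * c0) <= N / 8 by rewrite -e1 ler_peMl // ltW.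
have e3 : c0 * (L * h * V) <= N / 16.
  have : h * (16 * c0 * (L * V + 1)) <= N.
    by rewrite -ler_pdivlMr ?mulr_gt0 // ltW.
  have : 0 <= c0 * h by rewrite mulr_ge0 // ltW.
  nra.
have e4 : c0 * (B + L * h * P) <= c0 * (A + N / (8 * c0) + L * h * V + L * h * V).
  by rewrite ler_wpM2l ?lerD // ltW.
have : c0 * (N / (8 * c0)) <= c0 * A by rewrite e1; move: e4; rewrite !mulrDr e1; lra.
by rewrite ler_pM2l.
Qed.

End averages.

(** * Geometry of the elements *)

Section elements.
Context {R : realType} {n : nat}.
Local Notation mu := (@lebesgue_rV R n).
Implicit Types (x y : 'rV[R]_n) (K : set 'rV[R]_n).

Lemma normr_rV_le m (x : 'rV[R]_m) i : `|x ord0 i| <= `|x|.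
Proof.
rewrite [X in _ <= X]mx_normrE; exact: (@le_bigmax _ _ _ 0 (fun ij => `|x ij.1 ij.2|) (ord0, i)).
Qed.

Lemma normr_rV_leP m (x : 'rV[R]_m) (c : R) : 0 <= c ->
  (forall i, `|x ord0 i| <= c) -> `|x| <= c.
Proof.
move=> c0 h; rewrite [X in X <= _]mx_normrE; apply/bigmax_leP; split => // -[i j] _ /=.
by rewrite ord1.
Qed.

Lemma sum_coord_le m (x : 'rV[R]_m) : `|\sum_(i < m) x ord0 i| <= m%:R * `|x|.
Proof.
rewrite (le_trans (ler_norm_sum _ _ _)) // mulr_natl -[m in _ *+ m]card_ord -sumr_const.
by apply: ler_sum => i _; exact: normr_rV_le.
Qed.

(** The polytope is the image of the compact standard simplex under the map from barycentric
    coordinates to points. *)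
Lemma compact_polytope K : is_polytope K -> compact K.
Proof.
move=> [k [P ->]].
pose S : set 'rV[R]_k := cube 0 1 `&` [set a : 'rV[R]_k | \sum_i a ord0 i = 1].
pose F (a : 'rV[R]_k) : 'rV[R]_n := \sum_i a ord0 i *: P i.
have -> : [set x | exists a : 'I_k -> R, [/\ forall i, 0 <= a i, \sum_i a i = 1 &
    x = \sum_i a i *: P i]] = F @` S.
  apply/seteqP; split => [x [a [a0 a1 ->]]|_ [a [a0 a1] <-]].
    exists (\row_i a i); last by apply: eq_bigr => i _; rewrite mxE.
    split; last by rewrite /= -[RHS]a1; apply: eq_bigr => i _; rewrite mxE.
    move=> i; rewrite !mxE a0 add0r -a1 (bigD1 i) //= lerDl; exact: sumr_ge0.
  by exists (a ord0); split => // i; have := a0 i; rewrite mxE => /andP[].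
apply: continuous_compact; last first.
  apply: subclosed_compact (@compact_cube _ _ 0 1) _; last by move=> a [].
  apply: closedI; first by apply: compact_closed_rV; exact: compact_cube.
  have cs : continuous (fun a : 'rV[R]_k => \sum_i a ord0 i).
    apply: (@lipschitz_fun_continuous _ _ k%:R) => a b; rewrite -sumrB.
    rewrite (eq_bigr (fun i => (a - b) ord0 i)); last by move=> i _; rewrite !mxE.
    exact: sum_coord_le.
  exact: (preimage_closed (fun a _ => cs a) (@closed_eq _ 1)).
apply: continuous_subspaceT => a U /(nbhs_ballP (F a))[e /= e0 eU].
(* A Lipschitz constant of the barycentric map, increased by one to be positive. *)
pose C := \sum_i `|P i| + 1.
have C0 : 0 < C by rewrite ltr_wpDl // sumr_ge0.
apply/nbhs_ballP; exists (e / C); first by rewrite /= divr_gt0.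
move=> b; rewrite -ball_normE /= ltr_pdivlMr // => ab; apply: eU.
rewrite -ball_normE /= /F -sumrB (le_lt_trans _ ab) //.
rewrite (le_trans (ler_norm_sum _ _ _)) // /C mulrDr mulr1 -[leLHS]addr0 lerD //.
rewrite mulr_sumr; apply: ler_sum => i _; rewrite -scalerBl normrZ ler_wpM2r //.
by have := normr_rV_le (a - b) i; rewrite !mxE.
Qed.

Lemma enorm_ge x : `|x| <= enorm x.
Proof.
apply: normr_rV_leP; first exact: sqrtr_ge0.
move=> i; rewrite -sqrtr_sqr /enorm ler_wsqrtr // /dotp (bigD1 i) //= expr2 lerDl.
by apply: sumr_ge0 => j _; rewrite -expr2 sqr_ge0.
Qed.

Lemma enorm_le x : enorm x <= n%:R * `|x|.
Proof.
have c0 : 0 <= n%:R * `|x| by rewrite mulr_ge0.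
rewrite -(ger0_norm c0) -sqrtr_sqr /enorm ler_wsqrtr // /dotp.
apply: (@le_trans _ _ (\sum_(i < n) `|x| ^+ 2)).
  apply: ler_sum => i _; rewrite -expr2 -real_normK ?num_real //.
  by rewrite lerXn2r ?nnegrE // normr_rV_le.
rewrite sumr_const card_ord -[leLHS]mulr_natl exprMn ler_wpM2r ?sqr_ge0 //.
by rewrite -natrX ler_nat; case: (n) => // k; rewrite leq_pmulr.
Qed.

Lemma ediam_has_ubound K : compact K ->
  has_ubound [set enorm (x - y) | x in K & y in K].
Proof.
move=> /compact_bounded[M [Mr HM]]; exists (n%:R * ((`|M| + 1) + (`|M| + 1))).
move=> _ [x Kx [y Ky <-]]; rewrite (le_trans (enorm_le _)) // ler_wpM2l //.
have HK z : K z -> `|z| <= `|M| + 1 by apply: HM; rewrite ltr_pwDr // ler_norm.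
by rewrite (le_trans (ler_normB _ _)) // lerD // HK.
Qed.

Lemma ediam_ge K x y : compact K -> K x -> K y -> enorm (x - y) <= ediam K.
Proof. by move=> cK Kx Ky; apply: ub_le_sup; [exact: ediam_has_ubound|exists x => //; exists y]. Qed.

Lemma normr_le_ediam K x y : compact K -> K x -> K y -> `|x - y| <= ediam K.
Proof. by move=> cK Kx Ky; exact: le_trans (enorm_ge _) (ediam_ge cK Kx Ky). Qed.

Lemma enorm_dir (t : R) (i : 'I_n) : enorm (t *: delta_mx ord0 i) = `|t|.
Proof.
rewrite -sqrtr_sqr /enorm /dotp (bigD1 i) //= !mxE !eqxx /= mulr1 big1 ?addr0 //.
by move=> j ji; rewrite !mxE eqxx (negbTE ji) /= !mulr0.
Qed.

Let inball_set K := [set d : R | 0 <= d /\ exists x, forall y, enorm (y - x) <= d / 2 -> K y].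

(** The ends of a coordinate diameter of the ball lie in [K]. This bounds the set whose supremum is
    [inball_diam], so that the supremum is meaningful. *)
Lemma inball_le_ediam K d : (0 < n)%N -> compact K -> inball_set K d -> d <= ediam K.
Proof.
move=> n0 cK [d0 [x xK]]; pose e : 'rV[R]_n := delta_mx ord0 (Ordinal n0).
have d2 : `|d / 2| = d / 2 by rewrite ger0_norm // divr_ge0.
have K1 : K (x + (d / 2) *: e) by apply: xK; rewrite [X in enorm X]addrC addKr enorm_dir d2.
have K2 : K (x - (d / 2) *: e).
  by apply: xK; rewrite [X in enorm X]addrC addKr -scaleNr enorm_dir normrN d2.
have := ediam_ge cK K1 K2.
rewrite (_ : _ - _ = d *: e) ?enorm_dir ?ger0_norm //.
by rewrite opprB [_ - x]addrC addrACA subrr add0r -scalerDl -splitr.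
Qed.

Lemma inball_gt0 K : K°!=set0 -> exists2 e, 0 < e & inball_set K e.
Proof.
move=> [x /nbhs_ballP[e /= e0 eK]]; exists e => //; split; first exact: ltW.
exists x => y xy; apply: eK; rewrite -ball_normE /= distrC.
by rewrite (le_lt_trans (enorm_ge _)) // (le_lt_trans xy) // ltr_pdivrMr // ltr_pMr // ltr1n.
Qed.

Lemma ediam_gt0 K : (0 < n)%N -> compact K -> K°!=set0 -> 0 < ediam K.
Proof.
by move=> n0 cK /inball_gt0[e e0 eK]; exact: lt_le_trans e0 (inball_le_ediam n0 cK eK).
Qed.

(** A Euclidean ball of diameter h/(sigma+1) contains the sup-norm ball of radius 2 kap h, with kap
    this ratio, because the Euclidean norm is at most n times the sup norm. Using [sigma + 1] and
    [n.+1] makes the ratio at most 1 for every positive [sigma]. *)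
Definition inscribed_ratio (sigma : R) : R := (4 * (sigma + 1) * n.+1%:R)^-1.

Lemma inscribed_ratio_gt0 sigma : 0 < sigma -> 0 < inscribed_ratio sigma.
Proof. by move=> s0; rewrite invr_gt0 !mulr_gt0 // addr_gt0. Qed.

Lemma inscribed_ratio_le1 sigma : 0 < sigma -> inscribed_ratio sigma <= 1.
Proof.
move=> s0; rewrite invf_le1 ?mulr_gt0 ?addr_gt0 // -[leLHS]mul1r ler_pM //.
  by rewrite -[leLHS]mul1r ler_pM ?ler1n // lerDr ltW.
by rewrite ler1n.
Qed.

(** The centre of an inscribed ball of nearly maximal diameter serves as the lower corner of the
    cube; a larger open sup-norm ball around it lies in [K], which places the cube in the
    interior. *)
Lemma inscribed_cube K sigma : (0 < n)%N -> compact K -> K°!=set0 -> 0 < sigma ->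
  ediam K / inball_diam K < sigma ->
  exists c, cube c (inscribed_ratio sigma * ediam K) `<=` K°.
Proof.
move=> n0 cK K0 s0 reg; have h0 := ediam_gt0 n0 cK K0.
have [e e0 eK] := inball_gt0 K0.
have ub : has_ubound (inball_set K).
  by exists (ediam K) => d; exact: inball_le_ediam.
have tau0 : 0 < inball_diam K by apply: lt_le_trans e0 _; exact: ub_le_sup.
have : ediam K / (sigma + 1) < inball_diam K.
  rewrite ltr_pdivrMr ?addr_gt0 //; move: reg; rewrite ltr_pdivrMr // => reg.
  by rewrite (lt_trans reg) // mulrC ltr_pM2l // ltrDl.
(* The supremum need not be attained, so a ball of diameter above h/(sigma+1) is chosen. *)
move=> /(sup_gt (ex_intro _ e eK))[d [d0 [c cd]] hd].
exists c; set k := inscribed_ratio sigma.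
have k0 : 0 < k by exact: inscribed_ratio_gt0.
have ballK : ball c (2 * k * ediam K) `<=` K.
  move=> y; rewrite -ball_normE /= distrC => cy; apply: cd.
  rewrite (le_trans (enorm_le _)) //.
  apply: (@le_trans _ _ (n.+1%:R * (2 * k * ediam K))).
    by rewrite ler_pM // ?ler_nat // ltW.
  apply: (@le_trans _ _ (ediam K / (sigma + 1) / 2)); last by rewrite ler_wpM2r // ltW.
  rewrite le_eqVlt; apply/orP; left; apply/eqP; rewrite /k /inscribed_ratio.
  have s1 : sigma + 1 != 0 by rewrite gt_eqF // addr_gt0.
  by field; rewrite s1 nat1r pnatr_eq0.
have sub : ball c (2 * k * ediam K) `<=` K°.
  by rewrite -open_subsetE //; exact: ball_open.
move=> y yc; apply: sub; apply/ball_rVP; first by rewrite !mulr_gt0.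
move=> i; have := yc i => /andP[h1 h2].
have : 0 < k * ediam K by rewrite mulr_gt0.
by rewrite ltr_norml => ?; apply/andP; split; lra.
Qed.

Lemma lebesgue_le_ediam K : compact K -> K !=set0 ->
  (mu K <= ((2 * ediam K) ^+ n)%:E)%E.
Proof.
move=> cK [x Kx].
have h0 : 0 <= ediam K by rewrite (le_trans _ (normr_le_ediam cK Kx Kx)).
rewrite -(lebesgue_cube (\row_i (x ord0 i - ediam K))) ?mulr_ge0 //.
apply: le_measure; rewrite ?inE; [exact: compact_measurable_rV| |].
  by apply: compact_measurable_rV; exact: compact_cube.
move=> y Ky i; rewrite mxE.
have : `|(y - x) ord0 i| <= ediam K.
  by rewrite (le_trans (normr_rV_le _ _)) // normr_le_ediam.
by rewrite !mxE ler_norml => /andP[h1 h2]; apply/andP; split; lra.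
Qed.

End elements.

(** * Lp norms *)

Section lp_norms.
Context {R : realType} {n : nat}.
Local Notation mu := (@lebesgue_rV R n).
Implicit Types (D : set 'rV[R]_n) (W u : 'rV[R]_n -> R).

Lemma integral_patch D W :
  (\int[mu]_(x in D) `|W x|%:E = \int[mu]_x `|(EFin \o (W \_ D)) x|)%E.
Proof.
rewrite integral_mkcond; apply: eq_integral => x _; rewrite /= !patchE.
by case: ifP => //; rewrite normr0.
Qed.

(** Hoelder against the indicator of [D], whose norm for the conjugate exponent is mu(D)^(1-1/q).
    With the convention 1/oo = 0 one formula covers all exponents. *)
Lemma Lp_hoelder D (V : R) (q : \bar R) W : (1 <= q)%E -> measurable D ->
  measurable_fun D W -> (0 < V) -> (mu D <= V%:E)%E ->
  (\int[mu]_(x in D) `|W x|%:E <= (V `^ (1 - fine q^-1))%:E * Lp_norm D q W)%E.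
Proof.
move=> q1 mD mW V0 DV; rewrite integral_patch.
have mWD : measurable_fun setT (W \_ D) by exact/(measurable_restrictT _ mD).
case: q q1 => [q| |//] q1; last first.
  rewrite invey /= subr0 powRr1; last exact: ltW.
  (* The norm of exponent +oo is defined as 0 when the whole space has measure zero; the integral
     then vanishes as well. *)
  rewrite /Lp_norm unlock; case: ifPn => [muT|]; last first.
    rewrite -leNgt measure_le0 => /eqP mu0; rewrite mule0.
    rewrite (@integral_abs_eq0 _ _ _ mu setT (EFin \o (W \_ D))) //; exact/measurable_EFinP.
  set M := ess_sup _ _.
  have M0 : (0 <= M)%E by apply: ess_sup_gee => //; apply: nearW => x /=.
  have [->|Mfin] := eqVneq M +oo%E; first by rewrite gt0_muley ?leey // lte_fin.
  have MR : M \is a fin_num by rewrite ge0_fin_numE // lt_neqAle Mfin leey.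
  rewrite -(fineK MR).
  apply: (@le_trans _ _ (\int[mu]_(x in D) (fine M)%:E)%E); last first.
    by rewrite integral_cst // muleC lee_wpmul2r // fineK.
  rewrite -integral_patch.
  apply: ae_ge0_le_integral => //.
  - by apply/measurable_EFinP/measurableT_comp.
  - by move=> x _; rewrite lee_fin fine_ge0.
  - have := @ess_sup_ge _ _ _ mu (abse \o (EFin \o W \_ D)).
    apply: filterS => x /= h Dx; rewrite fineK //.
    by move: h; rewrite patchE mem_set.
have q0 : 0 < q by rewrite (lt_le_trans ltr01) // -lee_fin.
rewrite inver gt_eqF //=.
have [q_eq1|qn1] := eqVneq q 1.
  by rewrite q_eq1 invr1 subrr powRr0 mul1e /Lp_norm Lnorm1.
have q_gt1 : 1 < q by rewrite lt_neqAle eq_sym qn1 -lee_fin.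
have r0 : 0 < 1 - q^-1 by rewrite subr_gt0 invf_lt1.
have mI : measurable_fun setT (\1_D : 'rV[R]_n -> R) by exact: measurable_indic.
have := @hoelder _ _ _ mu (W \_ D) \1_D q (1 - q^-1)^-1 mWD mI q0
  ltac:(by rewrite invr_gt0) ltac:(by rewrite invrK addrC subrK).
rewrite (_ : (W \_ D \* \1_D)%R = W \_ D); last first.
  apply/funext => x /=; rewrite patchE indicE.
  by case: ifPn => _; rewrite ?mulr1 ?mul0r.
rewrite Lnorm1 => /le_trans; apply; rewrite muleC; apply: lee_wpmul2r.
  exact: Lnorm_ge0.
rewrite unlock /= invrK -poweR_EFin.
apply: gt0_ler_poweR => //.
- exact: ltW.
- by rewrite in_itv /= leey andbT integral_ge0 // => x _; exact: poweR_ge0.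
- by rewrite in_itv /= leey andbT lee_fin ltW.
rewrite (eq_integral (EFin \o \1_D)).
  by rewrite integral_indic // setIT.
move=> x _ /=; rewrite indicE; case: (x \in D) => /=.
  by rewrite normr1 powR1.
by rewrite normr0 powR0 // invr_eq0 gt_eqF.
Qed.

Lemma Lp_norm_le_sobolev_norm (j : nat) (q : \bar R) D u (be : mindex n) :
  (1 <= q)%E -> (mi_order be <= j)%N ->
  (Lp_norm D q (wderiv D be u) <= sobolev_norm j q D u)%E.
Proof.
move=> q1 bej; have fin := @finite_mi_order n j.
have L0 al : (0 <= Lp_norm D q (wderiv D al u))%E by exact: Lnorm_ge0.
have beA : be \in finmap.enum_fset (fset_set [set al : mindex n | (mi_order al <= j)%N]).
  by rewrite in_fset_set // inE.
rewrite /sobolev_norm; case: q q1 L0 => [q| |//] q1 L0.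
  have q0 : 0 < q by rewrite (lt_le_trans ltr01) // -lee_fin.
  rewrite -[leLHS]poweRe1 // -(mulfV (lt0r_neq0 q0)) poweRrM.
  have S0 : (0 <= \sum_(al \in [set al : mindex n | (mi_order al <= j)%N])
      Lp_norm D q%:E (wderiv D al u) `^ q)%E.
    by rewrite fsbig_finite //; apply: sume_ge0 => al _; exact: poweR_ge0.
  apply: gt0_ler_poweR; rewrite ?invr_ge0 ?(ltW q0) //.
  - by rewrite in_itv /= leey andbT poweR_ge0.
  - by rewrite in_itv /= leey andbT.
  rewrite fsbig_finite // (bigD1_seq be) //=; last exact: finmap.fset_uniq.
  by rewrite leeDl //; apply: sume_ge0 => al _; exact: poweR_ge0.
set F := fun al => Lp_norm D +oo (wderiv D al u).
have F0 s : (0 <= \big[maxe/0]_(al <- s) F al)%E.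
  by elim: s => [|al s IH]; rewrite ?big_nil ?big_cons // le_max IH orbT.
rewrite -/(F be).
(* The maximum ranges only over the indices where [F] is nonzero, so a zero value is treated
   apart. *)
have [->|Nbe] := eqVneq (F be) 0%E; first exact: F0.
have {}beA : be \in finite_support 0%E [set al : mindex n | (mi_order al <= j)%N] F.
  rewrite in_finite_support; last exact: finite_setIl.
  by rewrite inE; split => //; exact/eqP.
suff Fle s : be \in s -> (F be <= \big[maxe/0]_(al <- s) F al)%E by exact: Fle beA.
elim: s => // al s IH; rewrite inE big_cons le_max.
by case/predU1P => [<-|/IH ->]; rewrite ?lexx ?orbT.
Qed.

End lp_norms.

(** * Estimates on one element *)

Section element_estimates.
Context {R : realType} {n : nat}.
Local Notation mu := (@lebesgue_rV R n).
Implicit Types (D G : set 'rV[R]_n) (u v w uh P : 'rV[R]_n -> R).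

(** For t <= lam the left side is at most 0; beyond, lam^(p-1) <= t^(p-1) and t - lam <= t. *)
Lemma powR_tangent (p lam t : R) : 1 <= p -> 0 < lam -> 0 <= t ->
  lam `^ (p - 1) * (t - lam) <= t `^ p.
Proof.
move=> p1 l0 t0; have [tl|lt] := leP t lam.
  by rewrite (le_trans _ (powR_ge0 _ _)) // mulr_ge0_le0 ?powR_ge0 // subr_le0.
have tp : 0 < t by rewrite (lt_trans l0).
apply: (@le_trans _ _ (t `^ (p - 1) * t)).
  rewrite ler_pM ?powR_ge0 //; first by rewrite subr_ge0 ltW.
    by rewrite ge0_ler_powR ?nnegrE ?subr_ge0 ?(ltW l0) ?(ltW lt).
  by rewrite gerBl ltW.
rewrite -[X in _ * X <= _]powRr1 // -powRD; last first.
  by apply/implyP => _; rewrite gt_eqF.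
by rewrite subrK.
Qed.

Lemma fine_inve_itv (q : \bar R) : (1 <= q)%E -> 0 <= fine q^-1 <= 1.
Proof.
case: q => [q| |//] q1; last by rewrite invey /= lexx ler01.
have q0 : 0 < q by rewrite (lt_le_trans ltr01) // -lee_fin.
by rewrite inver gt_eqF //= invr_ge0 (ltW q0) invf_le1 // -lee_fin.
Qed.

(** The bump is differentiated r - j times and bounded in the sup norm, then Hoelder is applied on
    [D]. The constant in front is enlarged so as to depend neither on [j] nor on [q]. *)
Lemma element_error_bound D G r gamma u w uh P j (q : \bar R) c (kap h M : R) :
  open D -> open G -> D `<=` G -> mi_order gamma = r ->
  (forall al, (mi_order al <= r)%N -> exists v, is_weak_deriv G al u v) ->
  is_weak_deriv G gamma u w -> is_poly_deg_lt r P ->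
  (forall x, D x -> uh x = P x) -> (j <= r)%N -> (1 <= q)%E ->
  0 < kap -> kap <= 1 -> 0 < h -> cube c (kap * h) `<=` D ->
  (mu D <= ((2 * h) ^+ n)%:E)%E ->
  1 <= M -> (forall k t, (k <= r)%N -> `|bumpn k t : R| <= M) ->
  (`|\int[mu]_(x in G) (w x * tensor_bump c (kap * h) (fun=> 0%N) x)|%:E <=
   (kap^-1 ^+ r * M ^+ n * 2 ^+ n *
      h `^ (j%:R - r%:R + n%:R * (1 - fine q^-1)))%:E *
   sobolev_norm j q D (u \- uh)%R)%E.
Proof.
move=> oD oG DG gr uG uw polP uhP jr q1 kap0 kap1 h0 cD muD M1 HM.
have a0 : 0 < kap * h by rewrite mulr_gt0.
have [be [s [bej sj lW HW]]] := error_weak_deriv oD oG DG gr uG uw polP uhP jr.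
rewrite (HW _ (test_tensor_bump a0 cD)).
set W := wderiv D be (u \- uh); set psi := iter_partial s _.
have mD := open_measurable_rV oD.
have tpsi : test_function D psi by apply: test_function_iter; exact: test_tensor_bump.
have iWpsi := loc_integrable_test oD lW tpsi.
have mW : measurable_fun D W by case: lW.
have mpsi : measurable_fun D psi.
  by apply: continuous_measurable_rV; exact: test_function_continuous tpsi.
have sr : (size s <= r)%N by rewrite sj leq_subr.
have psiB := iter_partial_bump_le c a0 M1 HM sr.
(* Sup bound of the differentiated bump of side kap h. *)
pose B := (kap * h)^-1 ^+ (r - j) * M ^+ n.
have B0 : 0 <= B by rewrite mulr_ge0 ?exprn_ge0 ?invr_ge0 ?(ltW a0) // (le_trans ler01).
have step1 : (`|\int[mu]_(x in D) (W x * psi x)|%:E <= B%:E * \int[mu]_(x in D) `|W x|%:E)%E.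
  have -> : (`|\int[mu]_(x in D) (W x * psi x)|%:E = `|\int[mu]_(x in D) (W x * psi x)%:E|)%E.
    by rewrite -[in RHS](fineK (integrable_fin_num mD iWpsi)).
  apply: le_trans (le_abse_integral _ _ _) _ => //.
    by case/integrableP: iWpsi.
  rewrite -ge0_integralZl ?lee_fin //; last by apply/measurable_EFinP/measurableT_comp.
  apply: ge0_le_integral => //.
  - by apply: measurableT_comp => //; apply/measurable_EFinP; exact: measurable_funM.
  - by apply: measurable_funeM; apply/measurable_EFinP/measurableT_comp.
  - move=> x _; rewrite /= -EFinM lee_fin normrM mulrC ler_wpM2r //.
    by rewrite (le_trans (psiB x)) // sj.
have V0 : 0 < (2 * h) ^+ n by rewrite exprn_gt0 // mulr_gt0.
have step2 := Lp_hoelder q1 mD mW V0 muD.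
have step3 := @Lp_norm_le_sobolev_norm _ _ j q D (u \- uh) be q1 ltac:(by rewrite bej).
have /andP[qi0 qi1] := fine_inve_itv q1; set qi := fine _ in qi0 qi1 step2 *.
have N0 : (0 <= sobolev_norm j q D (u \- uh)%R)%E by apply: le_trans step3; exact: Lnorm_ge0.
apply: (le_trans step1).
apply: (@le_trans _ _ (B%:E * ((((2 * h) ^+ n) `^ (1 - qi))%:E * sobolev_norm j q D (u \- uh)%R))%E).
  apply: lee_wpmul2l; first by rewrite lee_fin.
  by apply: (le_trans step2); apply: lee_wpmul2l => //; rewrite lee_fin powR_ge0.
rewrite muleA -EFinM; apply: lee_wpmul2r => //; rewrite lee_fin.
have hj : h^-1 ^+ (r - j) = h `^ (j%:R - r%:R).
  by rewrite exprVn -powR_mulrn ?(ltW h0) // -powRN natrB // opprB.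
have e2 : ((2 * h) ^+ n) `^ (1 - qi) <= 2 ^+ n * h `^ (n%:R * (1 - qi)).
  rewrite exprMn powRM ?exprn_ge0 ?(ltW h0) // ler_pM ?powR_ge0 //.
    rewrite -[leRHS]powRr1 ?exprn_ge0 // ler_powR ?exprn_ege1 ?ler1n //.
    by rewrite gerBl.
  by rewrite -powR_mulrn ?(ltW h0) // -powRrM.
(* Since kap <= 1, the power r - j of 1/kap may be raised to r. *)
have e1 : B <= kap^-1 ^+ r * M ^+ n * h `^ (j%:R - r%:R).
  rewrite /B invfM exprMn hj mulrAC ler_wpM2r ?powR_ge0 //.
  rewrite ler_wpM2r ?exprn_ge0 ?(le_trans ler01) //.
  by rewrite ler_weXn2l ?leq_subr // invf_ge1.
rewrite [h `^ (_ + _)]powRD; last by apply/implyP => _; rewrite gt_eqF.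
apply: (le_trans (ler_pM B0 (powR_ge0 _ _) e1 e2)).
by rewrite le_eqVlt; apply/orP; left; apply/eqP; ring.
Qed.

(* With t = A / h^n, this is the tangent inequality [powR_tangent] times h^n. *)
Lemma element_term_bound (A C1 h lam p e0 : R) (N : \bar R) :
  0 <= A -> 0 < C1 -> 0 < h -> 0 < lam -> 1 <= p -> (0 <= N)%E ->
  (A%:E <= (C1 * h `^ e0)%:E * N)%E ->
  ((C1 `^ (- p) * lam `^ (p - 1) * (A - lam * h ^+ n))%:E <=
   (h `^ (p * (e0 + n%:R * (p^-1 - 1))))%:E * N `^ p)%E.
Proof.
move=> A0 C10 h0 l0 p1 N0 AN; have p0 : 0 < p by rewrite (lt_le_trans ltr01).
case: N N0 AN => [N| |//] N0 AN; last first.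
  rewrite poweRyr ?gt_eqF // gt0_muley ?leey // lte_fin powR_gt0 //.
rewrite poweR_EFin -EFinM lee_fin; move: AN; rewrite -EFinM lee_fin => AN.
rewrite lee_fin in N0.
have hn0 : 0 < h ^+ n by rewrite exprn_gt0.
have t0 : 0 <= A / h ^+ n by rewrite divr_ge0 // ltW.
have tang := powR_tangent p1 l0 t0.
apply: (@le_trans _ _ (C1 `^ (- p) * h ^+ n * (A / h ^+ n) `^ p)).
  have -> : A - lam * h ^+ n = h ^+ n * (A / h ^+ n - lam).
    by rewrite mulrBr mulrCA divff ?mulr1 ?gt_eqF // [lam * _]mulrC.
  rewrite -!mulrA ler_wpM2l ?powR_ge0 // mulrCA ler_wpM2l // ltW //.
apply: (@le_trans _ _ (C1 `^ (- p) * h ^+ n * (C1 * h `^ e0 * N / h ^+ n) `^ p)).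
  rewrite ler_wpM2l ?mulr_ge0 ?powR_ge0 ?(ltW hn0) //.
  rewrite ge0_ler_powR ?nnegrE ?(ltW p0) //.
    by rewrite divr_ge0 ?(ltW hn0) // !mulr_ge0 ?powR_ge0 ?(ltW C10).
  by rewrite ler_wpM2r // invr_ge0 ltW.
have hnE : h ^+ n = h `^ n%:R by rewrite powR_mulrn ?(ltW h0).
rewrite hnE -powRN.
rewrite !powRM ?mulr_ge0 ?powR_ge0 ?(ltW C10) // -!powRrM.
have -> : C1 `^ (- p) * h `^ n%:R *
    (C1 `^ p * h `^ (e0 * p) * N `^ p * h `^ (- n%:R * p)) =
    (C1 `^ (- p) * C1 `^ p) * (h `^ n%:R * h `^ (e0 * p) * h `^ (- n%:R * p)) * N `^ p.
  by ring.
have hD a b : h `^ a * h `^ b = h `^ (a + b).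
  by rewrite powRD //; apply/implyP => _; rewrite gt_eqF.
have -> : C1 `^ (- p) * C1 `^ p = 1 by rewrite powRN mulVf // gt_eqF // powR_gt0.
rewrite mul1r !hD.
rewrite (_ : n%:R + e0 * p + - n%:R * p = p * (e0 + n%:R * (p^-1 - 1))) //.
by field; rewrite gt_eqF.
Qed.

End element_estimates.

(** * Lower bound *)

Section mesh.
Context {R : realType} {n : nat}.
Local Notation mu := (@lebesgue_rV R n).
Implicit Types (D G K : set 'rV[R]_n) (T : set (set 'rV[R]_n)).

Lemma ediam_le_mesh_size T K : finite_set T -> T K -> ediam K <= mesh_size T.
Proof.
move=> fT TK; apply: ub_le_sup; last by exists K.
have : finite_set [set ediam K | K in T] by exact: finite_image.
move=> /finite_seqP[s ->]; exists (\big[Num.max/0]_(x <- s) x) => x /=.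
elim: s => // y s IH; rewrite inE big_cons le_max.
by case/predU1P => [->|/IH ->]; rewrite ?lexx ?orbT.
Qed.

Lemma bounded_set_sub D G : G `<=` D -> bounded_set D -> bounded_set G.
Proof. by move=> GD [M [Mr HM]]; exists M; split => // x Mx y /GD; exact: HM. Qed.

(** If the integral were zero, [w] would vanish almost everywhere on [G]. This converts the
    assumption in L^p into the L^1 mass that the averages work with. *)
Lemma Lp_norm_gt0_integral G (p : R) w : measurable G -> measurable_fun G w -> 0 < p ->
  (0 < Lp_norm G p%:E w)%E -> (0 < \int[mu]_(x in G) `|w x|%:E)%E.
Proof.
move=> mG mw p0 Lw; rewrite lt0e integral_ge0 // andbT; apply/eqP => I0.
have mwG : measurable_fun setT (EFin \o (w \_ G)).
  by apply/measurable_EFinP; exact/(measurable_restrictT _ mG).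
have : (\int[mu]_x `|(EFin \o (w \_ G)) x| = 0)%E by rewrite -integral_patch.
move=> /(ae_eq_integral_abs mu measurableT mwG) ae0.
move: Lw; rewrite /Lp_norm (_ : 'N[mu]_p%:E[_] = 0)%E ?ltxx //.
rewrite unlock (_ : (\int[mu]_x _ = 0)%E) ?poweR0r ?invr_eq0 ?gt_eqF //.
rewrite (ae_eq_integral (cst 0%E)) ?integral0 //.
- apply/measurable_EFinP/(@measurableT_comp _ _ _ _ _ _ (@powR R ^~ p)) => //.
  apply: measurableT_comp => //; exact/(measurable_restrictT _ mG).
- apply: filterS ae0 => x /= h _; have [->] := h I.
  by rewrite normr0 powR0 // gt_eqF.
Qed.

End mesh.

Section lower_bound.
Context {R : realType} {n : nat}.
Local Notation mu := (@lebesgue_rV R n).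
Variables (r : nat) (Omega G : set 'rV[R]_n).
Variables (u w : 'rV[R]_n -> R) (gamma : mindex n) (p : R).
Variables (I : Type) (T : I -> set (set 'rV[R]_n)) (uh : I -> 'rV[R]_n -> R).
Hypotheses (n0 : (0 < n)%N) (p1 : 1 <= p).
Hypotheses (oG : open G) (GO : G `<=` Omega) (bO : bounded_set Omega).
Hypothesis uG : forall al, (mi_order al <= r)%N -> exists v, is_weak_deriv G al u v.
Hypothesis gr : mi_order gamma = r.
Hypotheses (uw : is_weak_deriv G gamma u w) (Lw : in_Lp G p%:E w).
Hypothesis w_gt0 : (0 < Lp_norm G p%:E w)%E.
Hypothesis T_partition : forall i, is_partition Omega (T i).
Hypothesis T_regular : regular_family T.
Hypothesis uh_poly : forall i, piecewise_poly r (T i) (uh i).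

(** The l^1 bound on the tested averages is fed, element by element, into the error estimate and the
    tangent inequality. The first inequality of the theorem is the case q = p. *)
Lemma error_lower_bound (q : \bar R) : (1 <= q)%E ->
  exists C h0 : R, [/\ 0 < C, 0 < h0 &
    forall i (j : nat), mesh_size (T i) < h0 -> (j <= r)%N ->
      (C%:E <=
       (\sum_(K \in elements_in (T i) G)
          (ediam K `^
             (p * ((j%:R - r%:R) + n%:R * (p^-1 - fine q^-1))))%:E *
          sobolev_norm j q K° (u \- uh i)%R `^ p) `^ p^-1)%E].
Proof.
move=> q1; have p0 : 0 < p by rewrite (lt_le_trans ltr01).
have mG := open_measurable_rV oG.
have Goo : (mu G < +oo)%E by apply: lebesgue_rV_bounded => //; exact: bounded_set_sub bO.
have [mw Lwoo] := Lw.
have I_gt0 := Lp_norm_gt0_integral mG mw p0 w_gt0.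
pose V := fine (mu G); have VE : mu G = V%:E by rewrite fineK // ge0_fin_numE.
have V0 : 0 <= V by rewrite -lee_fin -VE.
(* On a set of finite measure L^p is contained in L^1; [V + 1] is a positive upper bound of the
   measure. *)
have iw : mu.-integrable G (EFin \o w).
  apply/integrableP; split; first exact/measurable_EFinP.
  apply: le_lt_trans (@Lp_hoelder _ _ G (V + 1) p%:E w _ mG mw _ _) _; rewrite ?lee_fin //.
  - by rewrite ltr_wpDl.
  - by rewrite VE lee_fin lerDl.
  - by rewrite lte_mul_pinfty // lee_fin powR_ge0.
have [sigma s0 reg] := T_regular.
pose kap := @inscribed_ratio R n sigma.
have kap0 : 0 < kap by exact: inscribed_ratio_gt0.
have kap1 : kap <= 1 by exact: inscribed_ratio_le1.
have [M M1 HM] := bump_bounded (R := R) r.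
(* int phi_K is at least c2 h_K^n, and mu(K) is at most (2 h_K)^n; [c0] is the quotient of the two
   constants. *)
pose c2 := (expR (- 8) * (kap / 2)) ^+ n.
have c2_gt0 : 0 < c2 by rewrite exprn_gt0 // mulr_gt0 ?expR_gt0 ?divr_gt0.
pose c0 := 2 ^+ n / c2.
have c01 : 1 <= c0.
  rewrite ler_pdivlMr // mul1r /c2 lerXn2r ?nnegrE ?mulr_ge0 ?expR_ge0 ?divr_ge0 ?(ltW kap0) //.
  have e1 : expR (- 8) <= 1 :> R by rewrite -[leRHS]expR0 ler_expR; lra.
  have k2 : 0 <= kap / 2 by rewrite divr_ge0 // ltW.
  by rewrite (le_trans (ler_wpM2r k2 e1)) // mul1r; lra.
have [c1 [h0 [c1_gt0 h0_gt0 H]]] := averages_lower_bound oG Goo iw I_gt0 c01.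
(* Bound for the sum of the h_K^n: each is at most int phi_K / c2, and these integrals add up to at
   most [V]. The choice of [lam] then gives lam * sum_K h_K^n <= c1/2. *)
pose V' := (V + 1) / c2; have V'0 : 0 < V' by rewrite divr_gt0 // ltr_wpDl.
pose lam := c1 / (2 * V'); have l0 : 0 < lam by rewrite divr_gt0 // mulr_gt0.
pose C1 := kap^-1 ^+ r * M ^+ n * 2 ^+ n.
have C10 : 0 < C1.
  have M0 : 0 < M by rewrite (lt_le_trans ltr01).
  by apply: mulr_gt0; [apply: mulr_gt0|]; apply: exprn_gt0 => //; rewrite invr_gt0.
pose c3 := C1 `^ (- p) * lam `^ (p - 1).
have c3_gt0 : 0 < c3 by rewrite mulr_gt0 // powR_gt0.
exists ((c3 * (c1 / 2)) `^ p^-1), h0; split => //.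
  by rewrite powR_gt0 // mulr_gt0 // divr_gt0.
move=> i j hT jr; have [fT TP OT Tdisj] := T_partition i.
set TG := elements_in (T i) G.
have fTG : finite_set TG by exact: finite_setIl.
rewrite fsbig_finite //=; set E := finmap.enum_fset _.
have EP K : K \in E -> T i K /\ K `<=` G.
  by rewrite /E in_fset_set // inE => -[].
have PE K : T i K -> K `<=` G -> K \in E.
  by move=> TK KG; rewrite /E in_fset_set // inE.
have geo K : T i K -> [/\ compact K, K° !=set0, 0 < ediam K, ediam K <= mesh_size (T i) &
    exists c, cube c (kap * ediam K) `<=` K°].
  move=> TK; have [pK K0] := TP K TK; have cK := compact_polytope pK.
  split => //; [exact: ediam_gt0|exact: ediam_le_mesh_size|].
  exact: inscribed_cube (reg i K TK).
have /choice[c cP] : forall K, exists c : 'rV[R]_n, T i K -> cube c (kap * ediam K) `<=` K°.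
  move=> K; have [TK|nTK] := pselect (T i K); last by exists 0.
  by have [_ _ _ _ [c cK]] := geo K TK; exists c.
(* Outside [E] there may be no inscribed cube, while continuity and the bounds 0 and 1 are demanded
   for every index. *)
pose phi K := if K \in E then tensor_bump (c K) (kap * ediam K) (fun=> 0%N) else fun=> 0.
have side K : T i K -> 0 < kap * ediam K.
  by move=> TK; have [_ _ hK _ _] := geo K TK; rewrite mulr_gt0.
pose h := Num.max 0 (mesh_size (T i)).
have hn K : K \in E -> c2 * ediam K ^+ n <= \int[mu]_(x in G) phi K x.
  move=> KE; have [TK KG] := EP K KE; rewrite /phi KE.
  have cG : cube (c K) (kap * ediam K) `<=` G.
    by apply: subset_trans (cP K TK) _; apply: subset_trans KG; exact: interior_subset.
  rewrite /c2 -exprMn.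
  have iphi : mu.-integrable G
      (EFin \o tensor_bump (c K) (kap * ediam K) (fun=> 0%N)).
    apply: measurable_bounded_integrable => //.
      by apply: continuous_measurable_rV; exact: continuous_tensor_bump.
    exists 1; split; first exact: num_real.
    have B y : `|tensor_bump (c K) (kap * ediam K) (fun=> 0%N) y| <= 1.
      by rewrite ger0_norm ?tensor_bump_ge0 // tensor_bump_le1.
    by move=> x x1 y _; exact: le_trans (B y) (ltW x1).
  rewrite -lee_fin fineK; last exact: (integrable_fin_num mG iphi).
  apply: le_trans (integral_tensor_bump_ge (side K TK) mG cG).
  by rewrite lee_fin le_eqVlt; apply/orP; left; apply/eqP; congr (_ ^+ _); field.
have [sumA sumphi] : c1 <= \sum_(K <- E) `|\int[mu]_(x in G) (w x * phi K x)| /\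
     \sum_(K <- E) \int[mu]_(x in G) phi K x <= fine (mu G).
  apply: (H _ E id phi h).
  - by rewrite /h le_max lexx.
  - by rewrite /h gt_max h0_gt0.
  - exact: finmap.fset_uniq.
  - move=> K; rewrite /phi; case: ifPn => _; last by move=> x; exact: cst_continuous.
    exact: continuous_tensor_bump.
  - move=> K x; rewrite /phi; case: ifPn => _; last by rewrite lexx ler01.
    by rewrite tensor_bump_ge0 tensor_bump_le1.
  - move=> K x KE Kx; have [TK KG] := EP K KE; rewrite /phi KE.
    by apply: tensor_bump_out => [|/(cP K TK)//]; exact: side.
  - move=> K K' /EP[TK _] /EP[TK' _] KK'; by have [] := Tdisj K K' TK TK' KK'.
  - move=> K KE; have [TK KG] := EP K KE; have [cK K0 hK hm _] := geo K TK; split => //.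
    + exact: compact_measurable_rV.
    + by case: K0 => x /interior_subset Kx; exists x.
    + move=> x y Kx Ky; rewrite (le_trans (normr_le_ediam cK Kx Ky)) //.
      by rewrite /h le_max hm orbT.
  - move=> K KE; have [TK KG] := EP K KE; have [cK K0 hK _ _] := geo K TK.
    apply: le_trans (lebesgue_le_ediam cK _) _.
      by case: K0 => x /interior_subset Kx; exists x.
    rewrite lee_fin exprMn /c0 -mulrA ler_wpM2l ?exprn_ge0 //.
    by rewrite mulrC ler_pdivlMr // mulrC hn.
  (* The point lies in some element because the mesh covers the closure of Omega; the diameter of
     that element is below [e], so it stays in the ball, hence in [G]. *)
  - move=> x e he xG.
    have Ox : closure Omega x.
      apply: subset_closure; apply: GO; apply: xG; apply: ballxx.
      by rewrite (le_lt_trans _ he) // /h le_max lexx.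
    move: Ox; rewrite OT => -[K TK Kx]; exists K => //; apply: PE => // y Ky.
    have [cK _ _ hm _] := geo K TK; apply: xG; rewrite -ball_normE /=.
    rewrite (le_lt_trans (normr_le_ediam cK Kx Ky)) // (le_lt_trans _ he) //.
    by rewrite /h le_max hm orbT.
have term K : K \in E ->
  ((c3 * (`|\int[mu]_(x in G) (w x * phi K x)| - lam * ediam K ^+ n))%:E <=
   (ediam K `^ (p * (j%:R - r%:R + n%:R * (p^-1 - fine q^-1))))%:E *
   sobolev_norm j q K° (u \- uh i)%R `^ p)%E.
  move=> KE; have [TK KG] := EP K KE; have [cK K0 hK _ _] := geo K TK.
  have [P polP uhP] := uh_poly TK.
  have := @element_error_bound R n K° G r gamma u w (uh i) P j q (c K) kap (ediam K) M
    (@open_interior _ K) oG (subset_trans (@interior_subset _ K) KG) gr uG uw polP uhP jr q1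
    kap0 kap1 hK (cP K TK) _ M1 HM.
  have -> : tensor_bump (c K) (kap * ediam K) (fun=> 0%N) = phi K by rewrite /phi KE.
  have muK : (mu K° <= ((2 * ediam K) ^+ n)%:E)%E.
    have K1 : K !=set0 by case: K0 => x /interior_subset Kx; exists x.
    apply: le_trans (lebesgue_le_ediam cK K1); apply: le_measure; rewrite ?inE.
    - by apply: open_measurable_rV; exact: open_interior.
    - exact: compact_measurable_rV.
    - exact: interior_subset.
  move=> /(_ muK) bound.
  have N0 : (0 <= sobolev_norm j q K° (u \- uh i)%R)%E.
    apply: (@le_trans _ _ (Lp_norm K° q (wderiv K° [ffun=> 0%N] (u \- uh i)%R))).
      exact: Lnorm_ge0.
    apply: Lp_norm_le_sobolev_norm => //.
    by rewrite /mi_order big1 // => k _; rewrite ffunE.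
  (* The exponent splits into the one from the element estimate and the shift n (1/p - 1) produced
     by the tangent inequality. *)
  have eE : p * (j%:R - r%:R + n%:R * (p^-1 - fine q^-1)) =
      p * (j%:R - r%:R + n%:R * (1 - fine q^-1) + n%:R * (p^-1 - 1)).
    by congr (p * _); ring.
  rewrite eE; exact: element_term_bound (normr_ge0 _) C10 hK l0 p1 N0 bound.
rewrite -poweR_EFin; apply: gt0_ler_poweR.
- by rewrite invr_ge0 ltW.
- by rewrite in_itv /= leey andbT lee_fin mulr_ge0 ?(ltW c3_gt0) // divr_ge0 // ltW.
- rewrite in_itv /= leey andbT; apply: sume_ge0 => K _.
  by rewrite mule_ge0 ?poweR_ge0 // lee_fin powR_ge0.
apply: (@le_trans _ _ (\sum_(K <- E)
    (c3 * (`|\int[mu]_(x in G) (w x * phi K x)| - lam * ediam K ^+ n))%:E)%E); last first.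
  by rewrite big_seq [leRHS]big_seq; apply: lee_sum => K; exact: term.
rewrite sumEFin lee_fin -mulr_sumr ler_pM2l // sumrB -mulr_sumr.
have sumh : \sum_(K <- E) ediam K ^+ n <= V'.
  rewrite /V' ler_pdivlMr // mulrC mulr_sumr.
  apply: (@le_trans _ _ (\sum_(K <- E) \int[mu]_(x in G) phi K x)).
    by rewrite big_seq [leRHS]big_seq; apply: ler_sum => K; exact: hn.
  by rewrite (le_trans sumphi) // lerDl.
have : lam * \sum_(K <- E) ediam K ^+ n <= c1 / 2.
  rewrite (le_trans (ler_wpM2l (ltW l0) sumh)) // /lam.
  by rewrite le_eqVlt; apply/orP; left; apply/eqP; field; rewrite gt_eqF.
lra.
Qed.

End lower_bound.

Theorem corollary3p2 (R : realType) (n r : nat) (Omega G : set 'rV[R]_n)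
    (f u : 'rV[R]_n -> R) (p delta : R) (gamma : mindex n)
    (I : Type) (T : I -> set (set 'rV[R]_n))
    (V : I -> set ('rV[R]_n -> R)) (uh : I -> 'rV[R]_n -> R)
    (n_ge1 : (1 <= n)%N) (r_ge1 : (1 <= r)%N) (p_ge1 : 1 <= p)
    (delta_gt0 : 0 < delta)
    (Omega_domain : is_domain Omega) (Omega_bounded : bounded_set Omega)
    (Omega_polytopic : is_polytopic Omega)
    (Omega_lipschitz : lipschitz_boundary Omega)
    (f_L2 : in_Lp Omega 2%:E f) (u_solution : poisson_solution Omega f u)
    (T_partition : forall i, is_partition Omega (T i))
    (T_regular : regular_family T)
    (V_fe : forall i, fe_space r (T i) (V i))
    (uh_solution : forall i, fe_solution Omega (T i) (V i) f (uh i))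
    (G_domain : is_domain G) (G_inside : compactly_inside G Omega)
    (u_reg : in_frac_sobolev (r%:R + delta) p G u)
    (gamma_order : mi_order gamma = r)
    (u_gamma : (0 < Lp_norm G p%:E (wderiv G gamma u))%E)
    (V_gamma : forall i v K x, V i v -> T i K -> K° x -> cderiv gamma v x = 0) :
  (exists C11 h0 : R, [/\ 0 < C11, 0 < h0 &
    forall i (j : nat), mesh_size (T i) < h0 -> (j <= r)%N ->
      (C11%:E <=
       (\sum_(K \in elements_in (T i) G)
          (ediam K `^ (p * (j%:R - r%:R)))%:E *
          sobolev_norm j p%:E K° (u \- uh i)%R `^ p) `^ p^-1)%E]) /\
  (forall q : \bar R, (1 <= q)%E ->
   exists C12 h0 : R, [/\ 0 < C12, 0 < h0 &
    forall i (j : nat), mesh_size (T i) < h0 -> (j <= r)%N ->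
      sobolev_embeds (r%:R + delta) p j q G ->
      (C12%:E <=
       (\sum_(K \in elements_in (T i) G)
          (ediam K `^
             (p * ((j%:R - r%:R) + n%:R * (p^-1 - fine q^-1))))%:E *
          sobolev_norm j q K° (u \- uh i)%R `^ p) `^ p^-1)%E]).
Proof.
have p_gt0 : 0 < p by rewrite (lt_le_trans ltr01).
(* Membership in the fractional space provides weak derivatives up to the integer part of r + delta,
   hence up to order r. *)
have rm : (r <= Num.truncn (r%:R + delta))%N.
  by rewrite truncn_ge_nat ?lerDl ?addr_ge0 ?ler0n // ltW.
have [sobolev_u _] := u_reg.
have [oG _ _] := G_domain; have [GO _ _] := G_inside.
have uG al : (mi_order al <= r)%N -> exists v, is_weak_deriv G al u v.
  by move=> alr; have [] := sobolev_u al (leq_trans alr rm).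
have [_ Lw] := sobolev_u gamma ltac:(by rewrite gamma_order).
have uw := wderivP (uG gamma ltac:(by rewrite gamma_order)).
have uh_poly i : piecewise_poly r (T i) (uh i).
  by have [VP _ _] := V_fe i; have [Vuh _] := uh_solution i; exact: VP.
have main := error_lower_bound n_ge1 p_ge1 oG GO Omega_bounded uG gamma_order uw Lw
  u_gamma T_partition T_regular uh_poly.
split=> [|q /main[C [h0 [C_gt0 h0_gt0 HC]]]]; last first.
  by exists C, h0; split => // i j hT jr _; exact: HC.
(* For q = p the term n (1/p - 1/q) of the exponent vanishes. *)
have [C [h0 [C_gt0 h0_gt0 HC]]] := main p%:E p_ge1.
exists C, h0; split => // i j hT jr; have := HC i j hT jr.
by rewrite inver gt_eqF //= subrr mulr0 addr0.
Qed.
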